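(* Let $m\in\mathbb{N}$, $m\geq 1$, and let $E_m=\{z\in\mathbb{C}:|z^m-1|\le1\}$. Let $\mu$ be a measure that is regular on $E_m$. Then there exists a subsequence $\mathcal{N}\subseteq\mathbb{N}$ of asymptotic density $1$ such that $$\lim_{\substack{n\to\infty\\ n\in\mathcal{N}}}\frac{(z^m-1)\,p_{n-m}(z;\mu)}{p_n(z;\mu)}=1$$ uniformly on compact subsets of $\overline{\mathbb{C}}\setminus\mathrm{ch}(\mu)$.
   Context: $\overline{\mathbb{C}}$ is the Riemann sphere. All measures are positive, finite, compactly supported Borel measures on $\mathbb{C}$ with infinite support. $p_n(z;\mu)=\kappa_n z^n+\cdots$, $\kappa_n>0$, is the degree-$n$ orthonormal polynomial of $\mu$: $\int \overline{p_n}\,p_m\,d\mu=\delta_{nm}$. $\mathrm{ch}(\mu)$ is the convex hull of $\mathrm{supp}(\mu)$. The polynomial convex hull of a compact set $K$ is $\mathrm{Pch}(K)=\bigcap_{p\ne0}\{z:|p(z)|\le\|p\|_{L^\infty(K)}\}$ (intersection over nonzero polynomials), equivalently the complement of the unbounded component of $\overline{\mathbb{C}}\setminus K$. The measure $\mu$ is called regular if $\lim_{n\to\infty}\kappa_n^{-1/n}=\mathrm{capacity}(\mathrm{supp}(\mu))$ (logarithmic capacity). For compact $K$, $\mu$ is regular on $K$ if $\mu$ is regular, $\mathrm{supp}(\mu)\subseteq K$, and the boundary of $\mathrm{Pch}(K)$ is contained in $\mathrm{supp}(\mu)$. A set $\mathcal{N}\subseteq\mathbb{N}$ has asymptotic density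 $1$ if $\lim_{n\to\infty}\#(\mathcal{N}\cap\{1,\dots,n\})/n=1$. Quotients are regarded as analytic at $\infty$; only $n\ge m$ is considered. *)

(* Defs.v *)
From HB Require Import structures.
From mathcomp Require Import all_boot all_order all_algebra.
From mathcomp Require Import complex.
From mathcomp Require Import all_classical all_reals all_analysis.

Set Implicit Arguments.
Unset Strict Implicit.
Unset Printing Implicit Defensive.

Import Order.TTheory GRing.Theory Num.Theory.
Import numFieldNormedType.Exports.

Local Open Scope classical_set_scope.
Local Open Scope ring_scope.

(* R[i] carries the topology of its norm and the Borel sigma-algebra. *)
HB.instance Definition _ (R : realType) := NormedModule.copy R[i] R[i]^o.
HB.instance Definition _ (R : realType) :=
  @isMeasurable.Build (sigma_display (@open R[i])) R[i] <<s @open R[i] >>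
    (@sigma_algebra0 _ setT _) (@sigma_algebraC _ _)
    (@sigma_algebra_bigcup _ setT _).

Section Definitions.
Variable R : realType.
Local Notation C := R[i].

(* `|z| lives in C; cabs z is the same number as an element of R. *)
Definition cabs (z : C) : R := complex.Re `|z|.

(* The complement of the largest open null set. *)
Definition msupp (mu : {measure set C -> \bar R}) : set C :=
  [set z | forall U, open U -> U z -> (0 < mu U)%E].

Definition convex_hull (A : set C) : set C :=
  \bigcap_(B in [set B | @convex_set R (Rcomplex R) B /\ A `<=` B]) B.

Definition boundary (A : set C) : set C := closure A `\` A°.

(* The sup is that of a nonempty bounded set when K is compact and nonempty. *)
Definition sup_norm (K : set C) (p : {poly C}) : R :=
  sup [set cabs p.[w] | w in K].

Definition Pch (K : set C) : set C :=
  [set z | forall p : {poly C}, p != 0 -> cabs p.[z] <= sup_norm K p].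

(* The double integral of log (1 / |z - w|); the kernel is +oo when z = w. *)
Definition log_energy (nu : {measure set C -> \bar R}) : \bar R :=
  (\int[nu]_z \int[nu]_w (- lne (cabs (z - w))%:E))%E.

(* exp (- V), where V is the minimal energy of a probability on K; a polar K
   has V = +oo and capacity 0. *)
Definition capacity (K : set C) : \bar R :=
  expeR (- ereal_inf [set log_energy nu |
                       nu in [set nu : probability C R | nu (~` K) = 0%E]])%E.

Definition Cintegral (mu : {measure set C -> \bar R}) (f : C -> C) : C :=
  ((\int[mu]_z complex.Re (f z)) +i* (\int[mu]_z complex.Im (f z)))%C.

(* In the order of R[i], 0 < x entails that x is real. *)
Definition orthonormal_polys (mu : {measure set C -> \bar R}) (p : nat -> {poly C}) :=
  (forall n, size (p n) = n.+1 /\ 0 < lead_coef (p n)) /\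
  (forall n k, Cintegral mu (fun z => ((p n).[z])^* * (p k).[z]) = (n == k)%:R).

(* The sequence p exists and is unique when supp mu is compact and infinite. *)
Definition regular (mu : {measure set C -> \bar R}) :=
  exists2 p : nat -> {poly C}, orthonormal_polys mu p &
    (complex.Re (lead_coef (p n)) `^ (- n%:R^-1))%:E @[n --> \oo]
      --> capacity (msupp mu).

Definition regular_on (K : set C) (mu : {measure set C -> \bar R}) :=
  [/\ regular mu, msupp mu `<=` K & boundary (Pch K) `<=` msupp mu].

Definition density_one (N : set nat) :=
  (count [in N] (iota 1 n))%:R / n%:R @[n --> \oo] --> (1 : R).

Definition sphere : Type := one_point_compactification C.
HB.instance Definition _ := Topological.on sphere.

Definition to_sphere (z : C) : sphere := Some z.

(* P / Q on the sphere, for deg P <= deg Q: the value at infinity is the limit,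
   that is, the quotient of the coefficients of degree deg Q. *)
Definition sphere_quot (P Q : {poly C}) (z : sphere) : C :=
  if z is Some w then P.[w] / Q.[w] else P`_(size Q).-1 / Q`_(size Q).-1.

End Definitions.

(* Main.v *)
(* Write f = z^m - 1 and kappa_n for the leading coefficient of p_n. Since
   |f| <= 1 on supp mu, expanding f p_(n-m) = r_n p_n + q_n with
   r_n = kappa_(n-m) / kappa_n and deg q_n < n gives r_n^2 + |q_n|^2 <= 1 in
   L^2(mu). Off the convex hull of supp mu, |q_n / p_n| is at most a constant
   times |q_n|, so f p_(n-m) / p_n is close to 1 as soon as r_n is close to 1.
   The sequence ln kappa_n is nondecreasing along steps of length m. The
   lemniscate |f| = 1 lies in supp mu, and the average of the images of the
   uniform measure of the circle under the m branches of the inverse of f is a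
   probability on it of energy at most 0. Hence
   capacity (supp mu) >= 1, and regularity gives ln kappa_n <= o(n). The
   increments ln kappa_n - ln kappa_(n-m) then have averages tending to 0, so
   they tend to 0 along a set of density 1. *)
From HB Require Import structures.
Require Import Defs.
From mathcomp Require Import all_boot all_order all_algebra.
From mathcomp Require Import ring lra zify.
From mathcomp Require Import complex.
From mathcomp Require Import all_classical all_reals all_analysis.
From mathcomp Require Import measurable_realfun.

Set Implicit Arguments.
Unset Strict Implicit.
Unset Printing Implicit Defensive.

Import Order.TTheory GRing.Theory Num.Theory.
Import numFieldNormedType.Exports.

Local Open Scope classical_set_scope.
Local Open Scope complex_scope.
Local Open Scope ring_scope.

(** The quotient is controlled without locating zeros: one inequality between [|q(z)|] and
    [|p_n(z)|], valid for every [q] of degree below [n], also gives [p_n(z) != 0] on taking [q = 1].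
    Its constant is [M / d], where [d] is the gap between [z] and the support in a suitable
    direction and [M] bounds the distances from [z] to the support. Both grow as [z] tends to
    infinity but their ratio stays bounded, so one constant serves a whole compact subset of the
    sphere. The energy bound rests on the circle: the potential [U] of its uniform measure satisfies
    [U(z^2) = 2 U(z)] for [|z| > 1], which with its sign for large [z] gives [U <= 0] there, and
    Fatou's lemma carries this to [|z| = 1]. On the lemniscate, the distances to the [m] preimages
    multiply to a distance between two points of the circle, so the potential of the averaged
    measure is [U / m] at a point of the circle. The kernel has no constant sign and takes the value
    [+oo]; shifts by [ln 3] and [ln 4], which bound the logarithms of the distances involved, reduce
    the estimates to nonnegative integrands. *)

Section ComplexPlane.
Variable R : realType.
Local Notation C := R[i].
Implicit Types (z w : C) (x y e : R).

(** * The real-valued modulus and the topology of the complex plane *)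

Lemma normE z : `|z| = (cabs z)%:C.
Proof. by rewrite /cabs normc_def. Qed.

Lemma cabsE z : cabs z = Num.sqrt ((complex.Re z) ^+ 2 + (complex.Im z) ^+ 2).
Proof. by rewrite /cabs normc_def. Qed.

Lemma cabs_ge0 z : 0 <= cabs z. Proof. by rewrite cabsE sqrtr_ge0. Qed.

Lemma cabs_sqr z : cabs z ^+ 2 = (complex.Re z) ^+ 2 + (complex.Im z) ^+ 2.
Proof. by rewrite cabsE sqr_sqrtr// addr_ge0// sqr_ge0. Qed.

Lemma cabs0 : cabs (0 : C) = 0. Proof. by rewrite /cabs normr0. Qed.
Lemma cabs1 : cabs (1 : C) = 1. Proof. by rewrite /cabs normr1. Qed.

Lemma cabs_eq0 z : (cabs z == 0) = (z == 0).
Proof.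
by rewrite -(normr_eq0 z) normE -(inj_eq (@complexI R)).
Qed.

Lemma cabs_gt0 z : (0 < cabs z) = (z != 0).
Proof. by rewrite lt_def cabs_eq0 cabs_ge0 andbT. Qed.

Lemma cabsM z w : cabs (z * w) = cabs z * cabs w.
Proof. by apply: (@complexI R); rewrite rmorphM/= -!normE normrM. Qed.

Lemma cabsX z n : cabs (z ^+ n) = cabs z ^+ n.
Proof. by elim: n => [|n ih]; rewrite ?expr0 ?cabs1// !exprS cabsM ih. Qed.

Lemma cabsV z : cabs z^-1 = (cabs z)^-1.
Proof. by apply: (@complexI R); rewrite fmorphV/= -!normE normfV. Qed.

Lemma cabsN z : cabs (- z) = cabs z.
Proof. by rewrite /cabs normrN. Qed.

Lemma cabsC z w : cabs (z - w) = cabs (w - z).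
Proof. by rewrite /cabs distrC. Qed.

Lemma cabs_conj z : cabs z^* = cabs z.
Proof. by rewrite !cabsE; case: z => a b /=; rewrite sqrrN. Qed.

Lemma le_cabsD z w : cabs (z + w) <= cabs z + cabs w.
Proof. by rewrite -lecR rmorphD/= -!normE ler_normD. Qed.

Lemma le_cabs_dist z w : `|cabs z - cabs w| <= cabs (z - w).
Proof.
have := le_cabsD (z - w) w; have := le_cabsD (w - z) z.
rewrite !subrK cabsC ler_norml => ? ?; lra.
Qed.

Lemma cabs_real x : cabs x%:C = `|x|.
Proof. by rewrite cabsE/= expr0n addr0 sqrtr_sqr. Qed.

Lemma Re_le_cabs z : `|complex.Re z| <= cabs z.
Proof. by rewrite -lecR -normE normc_ge_Re. Qed.

Lemma Im_le_cabs z : `|complex.Im z| <= cabs z.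
Proof.
have := Re_le_cabs (z * 'i%C); rewrite cabsM ReiNIm normrN.
by rewrite [cabs 'i%C]cabsE/= expr0n expr1n add0r sqrtr1 mulr1.
Qed.

Lemma cabs_le_ReIm z : cabs z <= `|complex.Re z| + `|complex.Im z|.
Proof.
rewrite -[leRHS]ger0_norm ?addr_ge0// -sqrtr_sqr cabsE ler_wsqrtr//.
rewrite sqrrD !real_normK ?num_real// -addrA lerD2l lerDr.
by rewrite mulrn_wge0// mulr_ge0.
Qed.

(** The radii of balls in [R[i]] are elements of [R[i]]; being positive they are real, and this
    passes to radii in [R]. *)
Lemma nbhs_cabsP z (A : set C) :
  nbhs z A <-> exists2 e : R, 0 < e & forall w, cabs (w - z) < e -> A w.
Proof.
split.
  move=> /nbhs_ballP[[e e'] /=]; rewrite ltcE/= => /andP[/eqP e'0 e0] eA.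
  exists e => // w wz; apply: eA; rewrite /ball/= distrC normE ltcE/=.
  by rewrite -e'0 eqxx.
move=> [e e0 eA]; apply/nbhs_ballP; exists e%:C => /=; first by rewrite ltcR.
by move=> w /=; rewrite /ball/= distrC normE ltcR => /eA.
Qed.

Lemma near_cabs z e : 0 < e -> \forall w \near z, cabs (w - z) < e.
Proof. by move=> e0; apply/nbhs_cabsP; exists e. Qed.

Lemma lipschitz_cts (f : C -> R) :
  (forall z w, `|f z - f w| <= cabs (z - w)) -> continuous f.
Proof.
have FF z : Filter (nbhs z) := nbhs_filter z.
move=> fl z; apply/(@cvgrPdist_lt _ _ _ _ (FF z)) => e e0; near=> w.
rewrite (le_lt_trans (fl _ _))// cabsC; near: w; exact: near_cabs.
Unshelve. all: by end_near. Qed.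

Lemma cts_Re : continuous (@complex.Re R : C -> R).
Proof.
apply: lipschitz_cts => z w; rewrite -(raddfB (@complex.Re R : Rcomplex R -> R)).
exact: Re_le_cabs.
Qed.

Lemma cts_Im : continuous (@complex.Im R : C -> R).
Proof.
apply: lipschitz_cts => z w; rewrite -(raddfB (@complex.Im R : Rcomplex R -> R)).
exact: Im_le_cabs.
Qed.

Lemma cts_cabs : continuous (@cabs R).
Proof. by apply: lipschitz_cts => z w; exact: le_cabs_dist. Qed.

Lemma cvg_complexP (T : Type) (F : set_system T) (FF : Filter F) (f : T -> C) z :
  (fun t => complex.Re (f t)) @ F --> complex.Re z ->
  (fun t => complex.Im (f t)) @ F --> complex.Im z -> f @ F --> z.
Proof.
move=> /cvgrPdist_lt fR /cvgrPdist_lt fI A /nbhs_cabsP[e e0 eA]; rewrite nbhs_filterE.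
have e20 : 0 < e / 2 by rewrite divr_gt0.
near=> t; apply: eA; rewrite cabsC; apply: le_lt_trans (cabs_le_ReIm _) _.
rewrite (raddfB (@complex.Re R : Rcomplex R -> R)) (raddfB (@complex.Im R : Rcomplex R -> R)).
rewrite [ltRHS]splitr; apply: ltrD; near: t; [exact: fR|exact: fI].
Unshelve. all: by end_near. Qed.

Lemma cts_complex (T : topologicalType) (f g : T -> R) :
  continuous f -> continuous g -> continuous (fun t => (f t +i* g t)%C : C).
Proof. by move=> cf cg t; apply: cvg_complexP; [exact: cf|exact: cg]. Qed.

Lemma cts_horner (p : {poly C}) : continuous (fun z : C => p.[z]).
Proof.
elim/poly_ind: p => [|p c ih] z.
  have -> : (fun z : C => (0 : {poly C}).[z]) = cst 0.
    by apply/funext => w; rewrite horner0.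
  exact: cst_continuous.
rewrite /continuous_at hornerMXaddC.
have -> : (fun z => (p * 'X + c%:P).[z]) = (fun z => p.[z] * z + c).
  by apply/funext => w; rewrite hornerMXaddC.
have F : Filter (nbhs z) := nbhs_filter z.
apply: (@cvgD C C^o C _ F (fun z => p.[z] * z) (fun=> c)); last exact: cvg_cst.
apply: (@cvgM C C _ F (fun z => p.[z]) id); [exact: ih|exact: cvg_id].
Qed.

(** A closed subset of the continuous image of the square [[- r, r] * [- r, r]]. *)
Lemma compact_disc (r : R) : compact [set z : C | cabs z <= r].
Proof.
pose q : set (R * R) := `[- r, r]%classic `*` `[- r, r]%classic.
have cq : compact q by apply: compact_setX; exact: segment_compact.
have ci : continuous (fun t : R * R => (t.1 +i* t.2)%C : C).
  by apply: cts_complex => t; [exact: cvg_fst|exact: cvg_snd].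
apply: subclosed_compact (continuous_compact (continuous_subspaceT ci) cq) _.
  by apply: (@closed_comp C R (@cabs R) [set x | x <= r]) => [z _|];
    [exact: cts_cabs|exact: closed_le].
move=> z /= zr; exists (complex.Re z, complex.Im z) => /=; last by case: (z).
have := Re_le_cabs z; have := Im_le_cabs z.
by rewrite !ler_norml => ? ?; split; rewrite /= in_itv/=; lra.
Qed.

Lemma compact_cabs_bounded (A : set C) : compact A ->
  exists2 M, 0 < M & forall z, A z -> cabs z <= M.
Proof.
move=> cA.
have : compact (@cabs R @` A).
  by apply: continuous_compact => //; apply: continuous_subspaceT; exact: cts_cabs.
move=> /compact_bounded[M [_ HM]]; exists (`|M| + 1); first by rewrite ltr_wpDl.
move=> z Az; have := HM (`|M| + 1).
rewrite (le_lt_trans (ler_norm M)) ?ltrDl// => /(_ erefl (cabs z)).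
by rewrite /= ger0_norm ?cabs_ge0//; apply; exists z.
Qed.

End ComplexPlane.

(** * Borel sets of the plane and the support of a measure *)

Section ComplexMeasurability.
Variable R : realType.
Local Notation C := R[i].

Lemma open_measurableC (U : set C) : open U -> measurable U.
Proof. by move=> oU; apply: sub_sigma_algebra. Qed.

Lemma closed_measurableC (U : set C) : closed U -> measurable U.
Proof.
by move=> cU; rewrite -(setCK U); apply: measurableC; apply: open_measurableC; exact: closed_openC.
Qed.

Lemma measurable_ctsC (f : C -> R) : continuous f -> measurable_fun setT f.
Proof.
move=> cf; apply: (measurability _ (RGenOInfty.measurableE R)) => // _ [_ [x ->] <-].
rewrite setTI; apply: open_measurableC; move/continuousP : cf; apply.
exact: interval_open.
Qed.

Definition rat_rectangle (i : rat * rat * (rat * rat)) : set C :=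
  [set z : C | (ratr i.1.1 < complex.Re z < ratr i.1.2) &&
               (ratr i.2.1 < complex.Im z < ratr i.2.2)].

(** An explicit countable base. It reduces Borel measurability into [C] to that of the two
    coordinates, and shows that the complement of the support is null. *)
Lemma open_rat_rectangles (U : set C) : open U ->
  U = \bigcup_(i in [set i | rat_rectangle i `<=` U]) rat_rectangle i.
Proof.
move=> oU.
apply/seteqP; split=> [z Uz|z [i iU]]; last exact: iU.
have /nbhs_cabsP[e e0 eU] : nbhs z U by exact: open_nbhs_nbhs.
have e4 : 0 < e / 4 by rewrite divr_gt0.
have hr (x : R) : exists q : rat * rat,
    (ratr q.1 < x < ratr q.2) && ((ratr q.2 - ratr q.1 : R) < e / 2).
  have /rat_in_itvoo[a ha] : x - e / 4 < x by rewrite ltrBlDr ltrDl.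
  have /rat_in_itvoo[b hb] : x < x + e / 4 by rewrite ltrDl.
  exists (a, b) => /=; move: ha hb; rewrite !in_itv/= => /andP[a1 a2] /andP[b1 b2].
  by rewrite a2 b1/=; lra.
have [q /andP[/andP[q1 q2] q3]] := hr (complex.Re z).
have [s /andP[/andP[s1 s2] s3]] := hr (complex.Im z).
exists (q, s); last by rewrite /rat_rectangle/= q1 q2 s1 s2.
move=> w /= /andP[/andP[w1 w2] /andP[w3 w4]]; apply: eU.
apply: le_lt_trans (cabs_le_ReIm _) _.
rewrite (raddfB (@complex.Re R : Rcomplex R -> R)) (raddfB (@complex.Im R : Rcomplex R -> R)).
rewrite [ltRHS]splitr; apply: ltrD; rewrite ltr_norml; apply/andP; split; lra.
Qed.

Lemma measurable_complex d (T : measurableType d) (D : set T) (f : T -> C) :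
  measurable_fun D (fun t => complex.Re (f t)) ->
  measurable_fun D (fun t => complex.Im (f t)) -> measurable_fun D f.
Proof.
move=> mR mI mD; suff : measurable_fun D f by apply.
have mE : @measurable _ C = <<s @open C >> by [].
suff X : preimage_set_system D f open `<=` @measurable _ T.
  exact: (@measurability _ _ T _ D f (@open C) mE X).
move=> A; case => U oU <-.
rewrite (open_rat_rectangles oU) preimage_bigcup setI_bigcupr.
rewrite bigcup_mkcond; apply: countable_bigcupT_measurable => [|i]; first exact: countableP.
case: ifPn => [_|_]; last exact: measurable0.
rewrite [X in measurable X](_ : _ = (D `&` (fun t => complex.Re (f t)) @^-1` `]ratr i.1.1, ratr i.1.2[)
   `&` (D `&` (fun t => complex.Im (f t)) @^-1` `]ratr i.2.1, ratr i.2.2[)).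
  by apply: measurableI; [exact: mR|exact: mI].
apply/seteqP; split=> t /=; rewrite !in_itv/=.
  by move=> [? /andP[? ?]].
by move=> [[? h1] [_ h2]]; split => //; apply/andP.
Qed.

Lemma msupp_closed (mu : {measure set C -> \bar R}) : closed (msupp mu).
Proof.
move=> z /= cz U oU Uz; have [w [sw Uw]] := cz U (open_nbhs_nbhs (conj oU Uz)).
exact: sw.
Qed.

(** A Lindelöf argument: a point off the support has a null open neighbourhood, hence lies in one of
    the countably many null rational rectangles. *)
Lemma measure_setC_msupp (mu : {measure set C -> \bar R}) : mu (~` msupp mu) = 0%E.
Proof.
set S := ~` msupp mu.
have oS : open S by apply: closed_openC; exact: msupp_closed.
pose N := [set i | mu (rat_rectangle i) = 0%E].
have oR i : open (rat_rectangle i).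
  rewrite (_ : rat_rectangle i = (@complex.Re R @^-1` `]ratr i.1.1, ratr i.1.2[)
      `&` (@complex.Im R @^-1` `]ratr i.2.1, ratr i.2.2[)).
    apply: openI; [move/continuousP : (@cts_Re R)|move/continuousP : (@cts_Im R)];
    by apply; exact: interval_open.
  apply/seteqP; split=> z; rewrite /rat_rectangle/= !in_itv/=; by [move=> /andP|move=> [-> ->]].
apply: measure_negligible; first exact: open_measurableC.
(* The rectangles are enumerated by their codes; codes of rectangles that are not null contribute
   the empty set. *)
apply: (@negligibleS _ _ _ mu (\bigcup_k (if unpickle k is Some i then
   if i \in N then rat_rectangle i else set0 else set0))).
  move=> z /= /existsNP[U /not_implyP[oU /not_implyP[Uz /negP]]].
  rewrite lt0e measure_ge0 andbT negbK => /eqP U0.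
  move: (Uz); rewrite {1}(open_rat_rectangles oU) => -[i /= iU iz].
  exists (pickle i); first exact: I.
  rewrite pickleK mem_set//.
  by apply: subset_measure0 iU U0; exact: open_measurableC.
apply: negligible_bigcup => k; case: unpickle => [i|]; last exact: negligible_set0.
case: ifPn => [|_]; last exact: negligible_set0.
by rewrite inE /N /= => i0; apply/negligibleP => //; exact: open_measurableC.
Qed.

End ComplexMeasurability.

(** * Integrals of continuous functions against a compactly supported measure *)

Section IntegralOnSupport.
Variable R : realType.
Local Notation C := R[i].
Variable mu : {finite_measure set C -> \bar R}.
Hypothesis mu_compact : compact (msupp mu).
Local Notation S := (msupp mu).
Implicit Types (f g : C -> R) (F G : C -> C).

Let mS : measurable S. Proof. by apply: closed_measurableC; exact: msupp_closed. Qed.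

Lemma cts_axpy (a : R) f g : continuous f -> continuous g ->
  continuous (fun z => a * f z + g z).
Proof.
move=> cf cg z; have FF : Filter (nbhs z) := nbhs_filter z.
apply: (@cvgD R R^o C _ FF (fun z => a * f z) g); last exact: cg.
apply: (@cvgM R C _ FF (fun=> a) f); [exact: cvg_cst|exact: cf].
Qed.

Lemma integrable_supp f : continuous f -> mu.-integrable S (EFin \o f).
Proof.
move=> cf; apply: measurable_bounded_integrable => //.
- by rewrite ltey_eq fin_num_measure.
- by apply: measurable_funTS; exact: measurable_ctsC.
- have : compact (f @` S).
    by apply: continuous_compact => //; apply: continuous_subspaceT.
  move=> /compact_bounded[M [Mr HM]]; exists M; split => // x Mx z Sz.
  by apply: HM => //; exists z.
Qed.

(** Continuous functions such as polynomials may be unbounded on the plane. On the compact support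
    they are bounded, hence integrable, and the complement is null. *)
Lemma Rintegral_supp f : continuous f ->
  (\int[mu]_z f z = \int[mu]_(z in S) f z)%R.
Proof.
move=> cf; have SE : setT `\` ~` S = S by rewrite setTD setCK.
have mCS : measurable (~` S) by exact: measurableC.
rewrite /Rintegral (@negligible_integral _ _ _ mu setT (~` S))//.
- by rewrite SE.
- apply/(@negligible_integrable _ _ _ mu setT (~` S)) => //.
  + by apply/measurable_EFinP; exact: measurable_ctsC.
  + exact: measure_setC_msupp.
  + by rewrite SE; exact: integrable_supp.
- exact: measure_setC_msupp.
Qed.

Lemma Rintegral_lin f g (a : R) : continuous f -> continuous g ->
  \int[mu]_z (a * f z + g z) = a * \int[mu]_z f z + \int[mu]_z g z.
Proof.
move=> cf cg.
have c0 : continuous (cst 0 : C -> R) by move=> z; exact: cst_continuous.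
have ca : continuous (fun z => a * f z).
  rewrite (_ : (fun z => a * f z) = (fun z => a * f z + cst 0 z)); first exact: cts_axpy.
  by apply/funext => z; rewrite addr0.
have cs := @cts_axpy a _ _ cf cg.
rewrite !Rintegral_supp// RintegralD//; [|exact: integrable_supp|exact: integrable_supp].
by rewrite RintegralZl//; exact: integrable_supp.
Qed.

Lemma Rintegral_mono f g : continuous f -> continuous g ->
  (forall z, S z -> f z <= g z) -> \int[mu]_z f z <= \int[mu]_z g z.
Proof.
move=> cf cg fg; rewrite !Rintegral_supp//.
by apply: le_Rintegral => //; exact: integrable_supp.
Qed.

Lemma Cintegral_lin F G (c : C) : continuous F -> continuous G ->
  Cintegral mu (fun z => c * F z + G z) = c * Cintegral mu F + Cintegral mu G.
Proof.
move=> cF cG.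
have cR (H : C -> C) : continuous H -> continuous (fun z => complex.Re (H z)).
  by move=> cH z; apply: (@continuous_comp _ _ _ H (@complex.Re R)); [exact: cH|exact: cts_Re].
have cI (H : C -> C) : continuous H -> continuous (fun z => complex.Im (H z)).
  by move=> cH z; apply: (@continuous_comp _ _ _ H (@complex.Im R)); [exact: cH|exact: cts_Im].
case: c => a b; rewrite /Cintegral.
have -> : (fun z => complex.Re ((a +i* b)%C * F z + G z)) =
    (fun z => a * complex.Re (F z) + (- b * complex.Im (F z) + complex.Re (G z))).
  by apply/funext => z; case: (F z) => ? ?; case: (G z) => ? ? /=; ring.
have -> : (fun z => complex.Im ((a +i* b)%C * F z + G z)) =
    (fun z => a * complex.Im (F z) + (b * complex.Re (F z) + complex.Im (G z))).
  by apply/funext => z; case: (F z) => ? ?; case: (G z) => ? ? /=; ring.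
rewrite !Rintegral_lin; try (by [apply: cR|apply: cI]);
  try (by apply: cts_axpy; [exact: cR|exact: cR]); try (by apply: cts_axpy; [exact: cI|exact: cR]);
  try (by apply: cts_axpy; [exact: cR|exact: cI]); try (by apply: cts_axpy; [exact: cI|exact: cI]).
by apply/eqP; rewrite eq_complex /=; apply/andP; split; apply/eqP; ring.
Qed.

End IntegralOnSupport.

(** * The inner product of polynomials in [L^2(mu)] *)

Section PolynomialInnerProduct.
Variable R : realType.
Local Notation C := R[i].
Variable mu : {finite_measure set C -> \bar R}.
Hypothesis mu_compact : compact (msupp mu).
Local Notation S := (msupp mu).
Implicit Types (P Q h : {poly C}) (c : C).

Definition ip P Q : C := Cintegral mu (fun z => (P.[z])^* * Q.[z]).
Definition nrm2 P : R := \int[mu]_z cabs P.[z] ^+ 2.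

Lemma cts_conj : continuous (fun z : C => z^*).
Proof.
move=> z; have FF : Filter (nbhs z) := nbhs_filter z.
move=> A /nbhs_cabsP[e e0 eA]; apply/nbhs_cabsP; exists e => // w wz.
by apply: eA; rewrite -rmorphB/= cabs_conj.
Qed.

Lemma cts_mulC (F G : C -> C) : continuous F -> continuous G -> continuous (fun z => F z * G z).
Proof.
move=> cF cG z; have FF : Filter (nbhs z) := nbhs_filter z.
by apply: (@cvgM C C _ FF F G); [exact: cF|exact: cG].
Qed.

Lemma cts_conj_mul P Q : continuous (fun z => (P.[z])^* * Q.[z]).
Proof.
apply: cts_mulC; last exact: cts_horner.
move=> z; apply: (@continuous_comp _ _ _ (horner P) (fun z : C => z^*)).
  exact: cts_horner.
exact: cts_conj.
Qed.

Lemma cts_ReF (F : C -> C) : continuous F -> continuous (fun z => complex.Re (F z)).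
Proof.
by move=> cF z; apply: (@continuous_comp _ _ _ F (@complex.Re R)); [exact: cF|exact: cts_Re].
Qed.

Lemma cts_ImF (F : C -> C) : continuous F -> continuous (fun z => complex.Im (F z)).
Proof.
by move=> cF z; apply: (@continuous_comp _ _ _ F (@complex.Im R)); [exact: cF|exact: cts_Im].
Qed.

Lemma cts_cabs2 P : continuous (fun z => cabs P.[z] ^+ 2).
Proof.
rewrite (_ : (fun _ => _) = fun z => complex.Re ((P.[z])^* * P.[z])).
  by apply: cts_ReF; exact: cts_conj_mul.
by apply/funext => z; rewrite cabs_sqr; case: P.[z] => a b /=; ring.
Qed.

Lemma ip_linr P Q1 Q2 c : ip P (c *: Q1 + Q2) = c * ip P Q1 + ip P Q2.
Proof.
rewrite /ip -Cintegral_lin//; [|exact: cts_conj_mul|exact: cts_conj_mul].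
by congr Cintegral; apply/funext => z; rewrite hornerD hornerZ; ring.
Qed.

Lemma ipC P Q : ip Q P = (ip P Q)^*.
Proof.
have cI : continuous (fun z => complex.Im ((P.[z])^* * Q.[z])).
  by apply: cts_ImF; exact: cts_conj_mul.
rewrite /ip /Cintegral; apply/eqP; rewrite eq_complex /=; apply/andP; split; apply/eqP.
  by apply: eq_Rintegral => z _; case: P.[z] => ? ?; case: Q.[z] => ? ? /=; ring.
have := @Rintegral_lin _ _ mu_compact _ (cst 0) (-1) cI (fun z => @cst_continuous _ _ _ _).
rewrite Rintegral_cst// mul0r addr0 mulN1r => <-.
by apply: eq_Rintegral => z _; case: P.[z] => ? ?; case: Q.[z] => ? ? /=; ring.
Qed.

Lemma ip0r P : ip P 0 = 0.
Proof. by have := ip_linr P 0 0 1; rewrite scaler0 addr0 mul1r => /eqP; rewrite -subr_eq subrr eq_sym => /eqP. Qed.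

Lemma ipZr P Q c : ip P (c *: Q) = c * ip P Q.
Proof. by have := ip_linr P Q 0 c; rewrite ip0r !addr0. Qed.

Lemma ipDr P Q1 Q2 : ip P (Q1 + Q2) = ip P Q1 + ip P Q2.
Proof. by have := ip_linr P Q1 Q2 1; rewrite scale1r mul1r. Qed.

Lemma ipZl P Q c : ip (c *: P) Q = c^* * ip P Q.
Proof. by rewrite ipC ipZr rmorphM/= -ipC. Qed.

Lemma ipDl P1 P2 Q : ip (P1 + P2) Q = ip P1 Q + ip P2 Q.
Proof. by rewrite ipC ipDr rmorphD/= -!ipC. Qed.

Lemma ip_nrm2 P : ip P P = (nrm2 P)%:C.
Proof.
rewrite /ip /Cintegral; apply/eqP; rewrite eq_complex /=; apply/andP; split; apply/eqP.
  by apply: eq_Rintegral => z _; rewrite cabs_sqr; case: P.[z] => a b /=; ring.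
rewrite (@eq_Rintegral _ _ _ _ _ (cst 0)) ?Rintegral_cst ?mul0r// => z _.
by case: P.[z] => a b /=; ring.
Qed.

Lemma nrm2_ge0 P : 0 <= nrm2 P.
Proof. by apply: Rintegral_ge0 => z _; exact: sqr_ge0. Qed.

Lemma nrm2_axpy P Q c :
  nrm2 (c *: P + Q) = cabs c ^+ 2 * nrm2 P + 2 * complex.Re (c * ip Q P) + nrm2 Q.
Proof.
have := ip_nrm2 (c *: P + Q); rewrite ipDr !ipDl !ipZr !ipZl !ip_nrm2 (ipC Q P) => /eqP.
rewrite eq_complex => /andP[/eqP + _] => /= <-; rewrite cabs_sqr.
by case: c => a b; case: (ip Q P) => u v /=; ring.
Qed.

Lemma nrm2_orth P Q c : ip Q P = 0 -> nrm2 (c *: P + Q) = cabs c ^+ 2 * nrm2 P + nrm2 Q.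
Proof. by move=> o; rewrite nrm2_axpy o mulr0 mulr0 addr0. Qed.

Lemma CauchySchwarz_ip P Q : cabs (ip P Q) ^+ 2 <= nrm2 P * nrm2 Q.
Proof.
set a := ip P Q.
have key s : 0 <= nrm2 Q - 2 * s * cabs a ^+ 2 + s ^+ 2 * cabs a ^+ 2 * nrm2 P.
  have := nrm2_ge0 ((- (s%:C * a)) *: P + Q).
  rewrite nrm2_axpy (ipC P Q) -/a cabsN cabsM cabs_real exprMn real_normK ?num_real//.
  set X := complex.Re _ => h; suff XE : X = - (s * cabs a ^+ 2) by move: h; rewrite XE; lra.
  by rewrite /X cabs_sqr; case: a {X h} => u v /=; ring.
(* If [nrm2 P = 0], the inequality [key] is affine in [s] and fails for large [s] unless [a = 0];
   otherwise the minimizing value is [s = 1 / nrm2 P]. *)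
have := nrm2_ge0 P; rewrite le_eqVlt => /predU1P[n0|n0].
  rewrite -n0 mul0r leNgt; apply/negP => a0.
  have := key ((nrm2 Q + 1) / cabs a ^+ 2); rewrite -n0 mulr0 addr0 -mulrA divfK ?gt_eqF//.
  by have := nrm2_ge0 Q; lra.
have := key (nrm2 P)^-1; rewrite -(pmulr_rge0 _ n0).
rewrite [X in 0 <= X -> _](_ : _ = nrm2 P * nrm2 Q - cabs a ^+ 2); last by field; rewrite gt_eqF.
by rewrite subr_ge0.
Qed.

(** For [h = u (X - z)] this turns the separation of [z] from the support into a coercivity estimate
    for multiplication by [X - z]. *)
Lemma Re_ip_mul_ge P h (d : R) : (forall w, S w -> d <= complex.Re h.[w]) ->
  d * nrm2 P <= complex.Re (ip P (h * P)).
Proof.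
move=> hd; rewrite /nrm2.
have c0 : continuous (cst 0 : C -> R) by move=> z; exact: cst_continuous.
have -> : d * (\int[mu]_z cabs P.[z] ^+ 2) = \int[mu]_z (d * cabs P.[z] ^+ 2 + cst 0 z).
  rewrite (Rintegral_lin mu_compact d (@cts_cabs2 P) c0).
  by rewrite Rintegral_cst// mul0r addr0.
apply: Rintegral_mono => //.
- exact: cts_axpy (@cts_cabs2 P) c0.
- exact: cts_ReF (@cts_conj_mul _ _).
move=> w /hd dw; rewrite addr0 hornerM.
rewrite (_ : complex.Re _ = complex.Re h.[w] * cabs P.[w] ^+ 2).
  by rewrite ler_wpM2r ?sqr_ge0.
by rewrite cabs_sqr; case: P.[w] => ? ?; case: h.[w] => ? ? /=; ring.
Qed.

Lemma nrm2_mul_le P h (M : R) : (forall w, S w -> cabs h.[w] <= M) ->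
  nrm2 (h * P) <= M ^+ 2 * nrm2 P.
Proof.
move=> hM; rewrite /nrm2.
have c0 : continuous (cst 0 : C -> R) by move=> z; exact: cst_continuous.
have -> : M ^+ 2 * (\int[mu]_z cabs P.[z] ^+ 2) = \int[mu]_z (M ^+ 2 * cabs P.[z] ^+ 2 + cst 0 z).
  rewrite (Rintegral_lin mu_compact (M ^+ 2) (@cts_cabs2 P) c0).
  by rewrite Rintegral_cst// mul0r addr0.
apply: Rintegral_mono => //.
- exact: cts_cabs2.
- exact: cts_axpy (@cts_cabs2 P) c0.
move=> w /hM dw; rewrite addr0 hornerM cabsM exprMn ler_wpM2r ?sqr_ge0//.
by rewrite lerXn2r// nnegrE ?cabs_ge0// (le_trans _ dw)// cabs_ge0.
Qed.

End PolynomialInnerProduct.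

(** * Orthonormal polynomials: pointwise comparison and leading coefficients *)

Section OrthonormalPolynomials.
Variable R : realType.
Local Notation C := R[i].
Variable mu : {finite_measure set C -> \bar R}.
Hypothesis mu_compact : compact (msupp mu).
Local Notation S := (msupp mu).

Definition kappa (p : nat -> {poly C}) n : R := complex.Re (lead_coef (p n)).

Section OneSequence.
Variable p : nat -> {poly C}.
Hypothesis hp : orthonormal_polys mu p.

Lemma size_orthonormal n : size (p n) = n.+1.
Proof. by have [/(_ n)[]] := hp. Qed.

Lemma lead_kappa n : lead_coef (p n) = (kappa p n)%:C.
Proof.
have [/(_ n)[_ ]] := hp; rewrite ltcE => /andP[/eqP I0 _] _.
by apply/eqP; rewrite eq_complex /= eqxx/= I0.
Qed.

Lemma kappa_gt0 n : 0 < kappa p n.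
Proof. by have [/(_ n)[_ ]] := hp; rewrite lead_kappa ltcR. Qed.

Lemma ip_orthonormal n k : ip mu (p n) (p k) = (n == k)%:R.
Proof. by have [_ hip] := hp; exact: hip. Qed.

Lemma nrm2_orthonormal n : nrm2 mu (p n) = 1.
Proof. by have := ip_nrm2 mu (p n); rewrite ip_orthonormal eqxx => /eqP; rewrite eq_complex => /andP[/eqP]. Qed.

Lemma coef_orthonormal n : (p n)`_n = (kappa p n)%:C.
Proof. by rewrite -lead_kappa /lead_coef size_orthonormal. Qed.

Lemma size_sub_lead n (Q : {poly C}) : (size Q <= n.+1)%N ->
  (size (Q - (Q`_n / (kappa p n)%:C) *: p n)%R <= n)%N.
Proof.
move=> sQ; apply/leq_sizeP => j; rewrite leq_eqVlt => /predU1P[<-|nj].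
  rewrite coefB coefZ coef_orthonormal divfK ?subrr//.
  by rewrite -[0]/(0%:C) (inj_eq (@complexI R)) gt_eqF// kappa_gt0.
rewrite coefB coefZ (nth_default _ (leq_trans sQ nj)).
by rewrite [(p n)`_j]nth_default ?size_orthonormal// mulr0 subr0.
Qed.

(** Subtracting multiples of [p k] for decreasing [k < n] removes the coefficients of [Q] from the
    top, so [Q] is a combination of these [p k]. *)
Lemma ip_lower n (Q : {poly C}) : (size Q <= n)%N -> ip mu (p n) Q = 0.
Proof.
suff : forall k, (k <= n)%N -> forall Q : {poly C}, (size Q <= k)%N -> ip mu (p n) Q = 0.
  by move=> /(_ n (leqnn n)); exact.
elim=> [_ {}Q|k ih kn {}Q sQ].
  by rewrite leqn0 size_poly_eq0 => /eqP ->; exact: ip0r.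
have -> : Q = (Q`_k / (kappa p k)%:C) *: p k + (Q - (Q`_k / (kappa p k)%:C) *: p k).
  by rewrite addrC subrK.
rewrite ip_linr// ip_orthonormal gtn_eqF// mulr0 add0r ih//; first exact: ltnW.
exact: size_sub_lead.
Qed.

(* With [b = q(z)] and [c = p_n(z)], the polynomial [b p_n - c q] vanishes at
   [z], hence is [(X - z) g] with [g] orthogonal to [p_n]; the separation of
   [z] from the support bounds [g], and [|b|^2 + |c|^2 |q|^2] is the squared
   norm of [(X - z) g]. *)
Lemma lower_degree_bound n (q : {poly C}) (z u : C) (d M : R) :
  (size q <= n)%N -> cabs u = 1 -> 0 < d ->
  (forall w, S w -> d <= complex.Re (u * (w - z))) ->
  (forall w, S w -> cabs (w - z) <= M) ->
  d ^+ 2 * cabs q.[z] ^+ 2 <= M ^+ 2 * (cabs (p n).[z] ^+ 2 * nrm2 mu q).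
Proof.
move=> sq u1 d0 hd hM.
set b := q.[z]; set c := (p n).[z].
have : root (b *: p n - c *: q) z by rewrite rootE !hornerE mulrC subrr.
move=> /factor_theorem[g gE].
have sg : (size g <= n)%N.
  have [->|g0] := eqVneq g 0; first by rewrite size_poly0.
  have : (size (g * ('X - z%:P))%R <= n.+1)%N.
    rewrite -gE (leq_trans (size_polyD _ _))// geq_max size_polyN.
    rewrite !(leq_trans (size_scale_leq _ _))// ?size_orthonormal//.
    exact: leq_trans (leqnSn n).
  by rewrite size_Mmonic ?monicXsubC// size_XsubC addn2.
have X2 : ip mu g (('X - z%:P) * g) = - c * ip mu g q.
  rewrite [('X - _) * g]mulrC -gE -scaleNr ip_linr//.
  by rewrite (ipC mu_compact (p n) g) ip_lower// conjC0 mulr0 add0r ipZr.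
(* Multiplication by [u (X - z)] has real part at least [d] on the support, while [X2] evaluates its
   pairing with [g]; the Cauchy-Schwarz inequality then bounds the norm of [g] by that of [q]. *)
have dg : d * nrm2 mu g <= cabs c * cabs (ip mu g q).
  have : d * nrm2 mu g <= complex.Re (ip mu g ((u *: ('X - z%:P)) * g)).
    by apply: Re_ip_mul_ge => // w /hd; rewrite !hornerE.
  rewrite -scalerAl ipZr// X2 => /le_trans; apply.
  apply: le_trans (ler_norm _) _; apply: le_trans (Re_le_cabs _) _.
  by rewrite !cabsM u1 mul1r cabsN.
have dg2 : d ^+ 2 * nrm2 mu g <= cabs c ^+ 2 * nrm2 mu q.
  have := nrm2_ge0 mu g; rewrite le_eqVlt => /predU1P[<-|g0].
    by rewrite mulr0 mulr_ge0// ?sqr_ge0// nrm2_ge0.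
  rewrite -(ler_pM2r g0).
  have h : (d * nrm2 mu g) ^+ 2 <= (cabs c * cabs (ip mu g q)) ^+ 2.
    by rewrite lerXn2r// nnegrE ?mulr_ge0 ?cabs_ge0// ltW// ltW.
  have -> : d ^+ 2 * nrm2 mu g * nrm2 mu g = (d * nrm2 mu g) ^+ 2 by ring.
  apply: le_trans h _; rewrite exprMn -[leRHS]mulrA.
  apply: ler_wpM2l; first exact: sqr_ge0.
  by rewrite mulrC; exact: CauchySchwarz_ip.
have bE : cabs b ^+ 2 <= nrm2 mu (b *: p n - c *: q).
  rewrite nrm2_orth//.
    by rewrite nrm2_orthonormal mulr1 lerDl nrm2_ge0.
  rewrite ipC// -scaleNr ipZr// ip_lower// mulr0 conjC0//.
have := nrm2_mul_le mu_compact g (h := 'X - z%:P) (M := M).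
rewrite [('X - _) * g]mulrC -gE => hh.
have {}hh : nrm2 mu (b *: p n - c *: q) <= M ^+ 2 * nrm2 mu g.
  by apply: hh => w /hM; rewrite !hornerE.
have := le_trans bE hh; rewrite -(ler_pM2l (exprn_gt0 2 d0)) => /le_trans; apply.
by rewrite mulrCA; apply: ler_wpM2l => //; exact: sqr_ge0.
Qed.

(** The bound for [q = 1], of degree below [n] because [0 < n], would read [d ^ 2 <= 0] at a zero of
    [p n]. This is Fejér's theorem that the zeros lie in the convex hull of the support, in its
    separated form. *)
Lemma horner_orthonormal_neq0 n (z u : C) (d : R) :
  (0 < n)%N -> cabs u = 1 -> 0 < d ->
  (forall w, S w -> d <= complex.Re (u * (w - z))) -> (p n).[z] != 0.
Proof.
move=> n0 u1 d0 hd; apply/negP => /eqP pz0.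
have [M M0 HM] := compact_cabs_bounded mu_compact.
have := @lower_degree_bound n 1 z u d (M + cabs z) _ u1 d0 hd.
rewrite size_poly1 => /(_ n0).
have hM w : S w -> cabs (w - z) <= M + cabs z.
  by move=> /HM wM; apply: le_trans (le_cabsD _ _) _; rewrite cabsN lerD2r.
move=> /(_ hM); rewrite pz0 cabs0 expr0n mul0r mulr0 hornerC cabs1 expr1n mulr1.
by rewrite leNgt exprn_gt0.
Qed.

Section MonicContraction.
Variables (f : {poly C}) (m : nat).
Hypothesis f_monic : f \is monic.
Hypothesis size_f : size f = m.+1.
Hypothesis f_le1 : forall w, S w -> cabs f.[w] <= 1.

(** With [remainder], these are the [r_n] and [q_n] of the overview. The subtraction [n - m] is
    truncated, hence the hypothesis [m <= n] wherever degrees are compared. *)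
Definition kratio n : R := kappa p (n - m) / kappa p n.
Definition remainder n := f * p (n - m)%N - (kratio n)%:C *: p n.

Lemma size_f_mul n : (m <= n)%N -> size (f * p (n - m)%N) = n.+1.
Proof.
move=> mn; rewrite size_monicM// -?size_poly_eq0 ?size_orthonormal//.
by rewrite size_f addSn/= addnS subnKC.
Qed.

Lemma coef_f_mul n : (m <= n)%N -> (f * p (n - m)%N)`_n = (kappa p (n - m))%:C.
Proof.
move=> mn; have := lead_coefM f (p (n - m)%N); rewrite (monicP f_monic) mul1r lead_kappa => <-.
by rewrite /lead_coef size_f_mul.
Qed.

Lemma size_remainder n : (m <= n)%N -> (size (remainder n) <= n)%N.
Proof.
move=> mn; have := @size_sub_lead n (f * p (n - m)%N).
by rewrite size_f_mul// coef_f_mul// /remainder /kratio rmorphM/= fmorphV => ->.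
Qed.

Lemma kratio_remainder n : (m <= n)%N ->
  kratio n ^+ 2 + nrm2 mu (remainder n) <= 1.
Proof.
move=> mn; have := nrm2_mul_le mu_compact (p (n - m)%N) f_le1.
rewrite expr1n mul1r nrm2_orthonormal; apply: le_trans.
have E : f * p (n - m)%N = (kratio n)%:C *: p n + remainder n by rewrite addrC subrK.
rewrite [X in _ <= nrm2 mu X]E.
rewrite nrm2_orth//; last by rewrite ipC// ip_lower ?conjC0// size_remainder.
by rewrite nrm2_orthonormal mulr1 cabs_real real_normK ?num_real.
Qed.

Lemma kratio_gt0 n : 0 < kratio n.
Proof. by rewrite divr_gt0// kappa_gt0. Qed.

Lemma kratio_le1 n : (m <= n)%N -> kratio n <= 1.
Proof.
move=> mn; rewrite -(@ler_pXn2r _ 2)// ?nnegrE ?ler01 ?(ltW (kratio_gt0 n))// expr1n.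
by apply: le_trans (kratio_remainder mn); rewrite lerDl nrm2_ge0.
Qed.

End MonicContraction.
End OneSequence.

(** [regular] asserts its limit for a sequence of its own. For two orthonormal sequences the inner
    product of the terms of index [n] is a quotient of leading coefficients, which is real;
    exchanging the arguments conjugates it and inverts the quotient, so the two positive numbers
    have equal squares. *)
Lemma kappa_unique (p p' : nat -> {poly C}) : orthonormal_polys mu p ->
  orthonormal_polys mu p' -> kappa p =1 kappa p'.
Proof.
have key (q q' : nat -> {poly C}) n : orthonormal_polys mu q -> orthonormal_polys mu q' ->
    ip mu (q n) (q' n) = (kappa q' n / kappa q n)%:C.
  move=> hq hq'; have := @size_sub_lead q hq n (q' n).
  rewrite (size_orthonormal hq') leqnn => /(_ erefl).
  rewrite (coef_orthonormal hq') => /(ip_lower hq).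
  rewrite -scaleNr ipDr// ipZr// (ip_orthonormal hq) eqxx mulr1 => /eqP.
  by rewrite subr_eq0 rmorphM/= fmorphV => /eqP.
move=> hp hp' n; have := ipC mu_compact (p n) (p' n); rewrite !key//.
have k0 := kappa_gt0 hp n; have k0' := kappa_gt0 hp' n.
move=> e; have {e} : (kappa p n / kappa p' n)%:C = (kappa p' n / kappa p n)%:C.
  by rewrite e; exact: conjc_real.
move=> /complexI/eqP.
rewrite (eqr_div _ _ (lt0r_neq0 k0') (lt0r_neq0 k0)).
by rewrite -!expr2 eqrXn2 ?ltW// => /eqP.
Qed.

End OrthonormalPolynomials.

(** By totality the upper sections form a filter base; by compactness it has a cluster point, which
    lies in every section since they are closed. It serves for the extreme directions as well as for
    the minimum of a linear form. *)
Lemma compact_total_max (T : ptopologicalType) (A : set T) (r : T -> T -> Prop) :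
  compact A -> A !=set0 -> (forall a, A a -> closed [set b | r a b]) ->
  (forall a b, A a -> A b -> r a b \/ r b a) ->
  (forall a b c, A a -> A b -> A c -> r a b -> r b c -> r a c) ->
  exists2 x, A x & forall a, A a -> r a x.
Proof.
move=> cA [a0 Aa0] clr tot tr.
pose F := filter_from A (fun a => A `&` [set b | r a b]).
have FF : ProperFilter F.
  apply: filter_from_proper; last by move=> a Aa; exists a; split => //; case: (tot a a Aa Aa).
  apply: filter_from_filter; first by exists a0.
  move=> a b Aa Ab; have [ab|ba] := tot a b Aa Ab.
  - by exists b => // c [Ac bc]; split; split => //; exact: tr ab bc.
  - by exists a => // c [Ac ac]; split; split => //; exact: tr ba ac.
have FA : F A by exists a0 => // b [].
have [x [Ax xF]] := cA F FF FA; exists x => // a Aa.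
apply: (clr a Aa) => U Ux.
have [||b [[Ab ab] Ub]] := xF (A `&` [set b | r a b]) U; [by exists a| by []|].
by exists b.
Qed.

(** * Separating a point from the convex hull of a compact set *)

Section Separation.
Variable R : realType.
Local Notation C := R[i].
Implicit Types (S : set C) (a b c w z u : C).

Definition cross a b : R := complex.Re a * complex.Im b - complex.Im a * complex.Re b.
Definition dot a b : R := complex.Re a * complex.Re b + complex.Im a * complex.Im b.

Lemma cross_dot_sqr a b : cross a b ^+ 2 + dot a b ^+ 2 = cabs a ^+ 2 * cabs b ^+ 2.
Proof. rewrite !cabs_sqr /cross /dot; ring. Qed.

Lemma cts_lin_ReIm (x y t : R) :
  continuous (fun z : C => x * complex.Re z + (y * complex.Im z + t)).
Proof.
apply: cts_axpy; first exact: cts_Re.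
apply: (@cts_axpy _ _ (@complex.Im R) (cst t)); first exact: cts_Im.
by move=> z; exact: cst_continuous.
Qed.

Lemma convex_hull_incl S : S `<=` convex_hull S.
Proof. by move=> w Sw B [_]; apply. Qed.

Lemma convex_hull_conv S a b (s t : R) : convex_hull S a -> convex_hull S b ->
  0 <= s -> 0 <= t -> s + t = 1 -> convex_hull S (s%:C * a + t%:C * b).
Proof.
move=> ha hb s0 t0 st B [cB SB].
have s01 : 0 <= s <= 1 by rewrite s0/=; lra.
have hB : a \in B /\ b \in B by rewrite !inE; split; [apply: ha|apply: hb].
have := cB a b (Itv01 s0 (andP s01).2) hB.1 hB.2; rewrite inE.
congr B; have -> : t = 1 - s by lra.
rewrite /conv/= /unstable.onem /GRing.scale/=.
by case: a {ha hB} => ? ?; case: b {hb} => ? ?; apply/eqP; rewrite eq_complex/=;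
  apply/andP; split; apply/eqP; ring.
Qed.

Section OutsidePoint.
Variables (S : set C) (z : C).
Hypothesis zS : ~ convex_hull S z.

(** Dividing by a positive total weight would write [z] as a convex combination of [a], [b], [c].
    The facts below on the angular order follow from suitable explicit weights. *)
Lemma positive_combination3 a b c (r s t : R) : S a -> S b -> S c ->
  0 <= r -> 0 <= s -> 0 <= t ->
  r%:C * (a - z) + s%:C * (b - z) + t%:C * (c - z) = 0 -> r + s + t = 0.
Proof.
move=> Sa Sb Sc r0 s0 t0 e0; apply/eqP/negPn/negP => T0.
have Tp : 0 < r + s + t by rewrite lt_def T0/= !addr_ge0.
have ha := convex_hull_incl Sa; have hb := convex_hull_incl Sb; have hc := convex_hull_incl Sc.
apply: zS; have zE : z = (r / (r + s + t))%:C * a + (s / (r + s + t))%:C * b + (t / (r + s + t))%:C * c.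
  have TC : (r + s + t)%:C != 0 by rewrite -[0]/(0%:C) (inj_eq (@complexI R)).
  apply: (mulfI TC); rewrite !mulrDr !mulrA -!rmorphM/= ![(r + s + t) * _]mulrC !divfK//.
  apply/eqP; rewrite -subr_eq0 -oppr_eq0 -e0 !rmorphD/=; apply/eqP; ring.
(* Convexity concerns two points at a time: [b] and [c] are merged first, which requires [s + t] to
   be nonzero. *)
have [st0|st0] := eqVneq (s + t) 0.
  have [s00 t00] : s = 0 /\ t = 0 by lra.
  rewrite zE s00 t00 !mul0r !addr0 divff ?mul1r//.
  by move: T0; rewrite s00 t00 !addr0.
have stp : 0 < s + t by rewrite lt_def st0/= addr_ge0.
rewrite zE -addrA.
have -> : (s / (r + s + t))%:C * b + (t / (r + s + t))%:C * c =
   ((s + t) / (r + s + t))%:C * ((s / (s + t))%:C * b + (t / (s + t))%:C * c).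
  rewrite mulrDr !mulrA -!rmorphM/=; congr (_%:C * _ + _%:C * _); field; rewrite ?gt_eqF//; lra.
apply: convex_hull_conv => //.
- apply: convex_hull_conv => //; rewrite ?divr_ge0 ?(ltW stp)//.
  by rewrite -mulrDl divff.
- by rewrite divr_ge0// ltW.
- by rewrite divr_ge0// ltW.
- by rewrite -mulrDl addrA divff.
Qed.

Lemma outside_neq0 a : S a -> 0 < cabs (a - z).
Proof.
move=> Sa; rewrite cabs_gt0; apply/negP => /eqP a0.
have := @positive_combination3 a a a 1 0 0 Sa Sa Sa.
by rewrite a0 !mulr0 !addr0 ler01 lexx => /(_ erefl erefl erefl erefl)/eqP; rewrite oner_eq0.
Qed.

(** By Lagrange's identity the dot product of parallel vectors is plus or minus the product of their
    lengths, and the minus sign would put [z] on the segment from [a] to [b]. *)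
Lemma parallel_dot_gt0 a b : S a -> S b -> cross (a - z) (b - z) = 0 -> 0 < dot (a - z) (b - z).
Proof.
move=> Sa Sb c0; have na := outside_neq0 Sa; have nb := outside_neq0 Sb.
have := cross_dot_sqr (a - z) (b - z); rewrite c0 expr0n add0r -exprMn => /eqP.
rewrite eqf_sqr => /orP[/eqP ->|/eqP dE]; first exact: mulr_gt0.
have := @positive_combination3 a b b (cabs (b - z)) (cabs (a - z)) 0 Sa Sb Sb
  (cabs_ge0 _) (cabs_ge0 _) (lexx _).
rewrite mul0r !addr0 => h; suff /h : (cabs (b - z))%:C * (a - z) + (cabs (a - z))%:C * (b - z) = 0.
  by move=> e; have : 0 < cabs (b - z) + cabs (a - z) by [exact: addr_gt0]; rewrite e ltxx.
apply/eqP; rewrite -cabs_eq0 -sqrf_eq0 cabs_sqr; apply/eqP.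
have ha := cabs_sqr (a - z); have hb := cabs_sqr (b - z); move: dE ha hb; rewrite /dot.
move: (cabs (a - z)) (cabs (b - z)) => A B.
case: (a - z) => x y; case: (b - z) => x' y' /= dE ha hb.
have -> : (B * x - 0 * y + (A * x' - 0 * y')) ^+ 2 + (B * y + 0 * x + (A * y' + 0 * x')) ^+ 2
  = B ^+ 2 * (x ^+ 2 + y ^+ 2) + A ^+ 2 * (x' ^+ 2 + y' ^+ 2) + 2 * A * B * (x * x' + y * y') by ring.
by rewrite dE -ha -hb; ring.
Qed.

(** Any three plane vectors satisfy [cross b c * a - cross a c * b + cross a b * c = 0]. If
    [cross a c < 0], the three weights are nonnegative and not all zero, contrary to
    [positive_combination3]. *)
Lemma cross_trans a b c : S a -> S b -> S c ->
  0 <= cross (a - z) (b - z) -> 0 <= cross (b - z) (c - z) -> 0 <= cross (a - z) (c - z).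
Proof.
move=> Sa Sb Sc ab bc; rewrite leNgt; apply/negP => ac.
have := @positive_combination3 a b c (cross (b - z) (c - z)) (- cross (a - z) (c - z))
  (cross (a - z) (b - z)) Sa Sb Sc bc _ ab.
rewrite oppr_ge0 ltW// => /(_ erefl) h.
suff /h : (cross (b - z) (c - z))%:C * (a - z) + (- cross (a - z) (c - z))%:C * (b - z) +
  (cross (a - z) (b - z))%:C * (c - z) = 0 by lra.
rewrite /cross; case: (a - z) => ? ?; case: (b - z) => ? ?; case: (c - z) => ? ?.
by apply/eqP; rewrite eq_complex/=; apply/andP; split; apply/eqP; ring.
Qed.

Lemma crossC a b : cross a b = - cross b a.
Proof. by rewrite /cross; ring. Qed.

(* Seen from [z], the points of [S] are totally preordered by angle, because
   three of them never surround [z]; the bisector of the extreme directions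
   separates. *)
Lemma positive_direction : compact S -> S !=set0 ->
  exists v : C, forall w, S w -> 0 < dot v (w - z).
Proof.
move=> cS S0.
have tot a b : S a -> S b -> 0 <= cross (a - z) (b - z) \/ 0 <= cross (b - z) (a - z).
  by move=> _ _; rewrite (crossC (b - z)) oppr_ge0; case: (lerP 0 (cross (a - z) (b - z))) => h;
    [left|right; exact: ltW].
have cl (x y t : R) : closed [set b : C | 0 <= x * complex.Re b + (y * complex.Im b + t)].
  apply: (@closed_comp C R _ [set s | 0 <= s]); last exact: closed_ge.
  by move=> b _; exact: cts_lin_ReIm.
have [w2 S2 H2] : exists2 x, S x & forall a, S a -> 0 <= cross (a - z) (x - z).
  apply: (@compact_total_max C S (fun a b => 0 <= cross (a - z) (b - z))) => //.
    move=> a Sa; have := cl (- complex.Im (a - z)) (complex.Re (a - z))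
      (complex.Im (a - z) * complex.Re z - complex.Re (a - z) * complex.Im z).
    congr closed; apply/seteqP; split=> b /=; congr (0 <= _ : Prop);
      rewrite /cross; case: (a) => ? ?; case: (b) => ? ?; case: (z) => ? ? /=; ring.
  exact: cross_trans.
have [w1 S1 H1] : exists2 x, S x & forall a, S a -> 0 <= cross (x - z) (a - z).
  apply: (@compact_total_max C S (fun a b => 0 <= cross (b - z) (a - z))) => //.
  - move=> a Sa; have := cl (complex.Im (a - z)) (- complex.Re (a - z))
      (- complex.Im (a - z) * complex.Re z + complex.Re (a - z) * complex.Im z).
    congr closed; apply/seteqP; split=> b /=; congr (0 <= _ : Prop);
      rewrite /cross; case: (a) => ? ?; case: (b) => ? ?; case: (z) => ? ? /=; ring.
  - by move=> a b Sa Sb; apply: tot.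
  - by move=> a b c Sa Sb Sc ab bc; exact: cross_trans bc ab.
have n1 := outside_neq0 S1; have n2 := outside_neq0 S2.
exists (((cabs (w1 - z))^-1)%:C * (w1 - z) + ((cabs (w2 - z))^-1)%:C * (w2 - z)) => w Sw.
set n := cabs (w1 - z) in n1 *; set n' := cabs (w2 - z) in n2 *.
have dE v : dot ((n^-1)%:C * (w1 - z) + (n'^-1)%:C * (w2 - z)) v =
   n^-1 * dot (w1 - z) v + n'^-1 * dot (w2 - z) v.
  by rewrite /dot; case: (w1 - z) => ? ?; case: (w2 - z) => ? ?; case: v => ? ? /=; ring.
rewrite dE; set D := cross (w1 - z) (w2 - z).
have al := H2 _ Sw; have be := H1 _ Sw.
(* Cramer's rule: up to the factor [D], the coordinates of [w - z] along the two extreme directions,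
   both nonnegative by the choice of [w1] and [w2]. *)
have idc : (cross (w - z) (w2 - z))%:C * (w1 - z) + (cross (w1 - z) (w - z))%:C * (w2 - z) =
   D%:C * (w - z).
  rewrite /D /cross; case: (w1 - z) => ? ?; case: (w2 - z) => ? ?; case: (w - z) => ? ?.
  by apply/eqP; rewrite eq_complex/=; apply/andP; split; apply/eqP; ring.
(* If the extreme directions are parallel, both coordinates vanish, so [w - z] is parallel to each
   of them. *)
have [D0|D0] := eqVneq D 0.
  have := @positive_combination3 w1 w2 w2 _ _ 0 S1 S2 S2 al be (lexx _).
  rewrite idc D0 !mul0r !addr0 => /(_ erefl) ab0.
  have [a0 b0] : cross (w - z) (w2 - z) = 0 /\ cross (w1 - z) (w - z) = 0 by lra.
  apply: addr_gt0; apply: mulr_gt0; rewrite ?invr_gt0//; apply: parallel_dot_gt0 => //.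
  by rewrite crossC a0 oppr0.
have Dp : 0 < D by rewrite lt_def D0; exact: H1.
have dn : `|dot (w1 - z) (w2 - z)| < n * n'.
  rewrite -(@ltr_pXn2r _ 2)// ?nnegrE ?mulr_ge0 ?(ltW n1) ?(ltW n2)//.
  rewrite real_normK ?num_real// exprMn -cross_dot_sqr ltrDr exprn_gt0//.
have nn : 0 < n * n' by exact: mulr_gt0.
move: dn; rewrite ltr_norml => /andP[dn _].
rewrite -(pmulr_rgt0 _ Dp) -(pmulr_rgt0 _ nn).
have -> : n * n' * (D * (n^-1 * dot (w1 - z) (w - z) + n'^-1 * dot (w2 - z) (w - z))) =
   n' * dot (w1 - z) (D%:C * (w - z)) + n * dot (w2 - z) (D%:C * (w - z)).
  rewrite /dot; case: (w1 - z) => ? ?; case: (w2 - z) => ? ?; case: (w - z) => ? ? /=.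
  by field; rewrite !gt_eqF.
rewrite -idc.
set x := cross (w - z) (w2 - z) in al idc *; set y := cross (w1 - z) (w - z) in be idc *.
(* For unit vectors [e1], [e2] along the extreme directions, the product of [e1 + e2] with
   [x n e1 + y n' e2] is [(x n + y n') (1 + e1.e2)]; the last factor is positive since the
   directions are not opposite. *)
have -> : n' * dot (w1 - z) (x%:C * (w1 - z) + y%:C * (w2 - z)) +
          n * dot (w2 - z) (x%:C * (w1 - z) + y%:C * (w2 - z)) =
   (x * n + y * n') * (n * n' + dot (w1 - z) (w2 - z)).
  have ha := cabs_sqr (w1 - z); have hb := cabs_sqr (w2 - z); move: ha hb.
  rewrite -/n -/n' /dot.
  case: (w1 - z) => p q; case: (w2 - z) => r s /= ha hb.
  transitivity (n' * (x * (p ^+ 2 + q ^+ 2) + y * (p * r + q * s)) +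
    n * (y * (r ^+ 2 + s ^+ 2) + x * (p * r + q * s))); first by ring.
  by rewrite -ha -hb; ring.
apply: mulr_gt0; last by lra.
rewrite lt_def addr_ge0 ?mulr_ge0 ?(ltW n1) ?(ltW n2)// andbT; apply/negP.
rewrite paddr_eq0 ?mulr_ge0 ?(ltW n1) ?(ltW n2)// !mulf_eq0 (gt_eqF n1) (gt_eqF n2) !orbF.
move=> /andP[/eqP x0 /eqP y0]; have := outside_neq0 Sw; move: idc.
rewrite x0 y0 !mul0r addr0 => /esym/eqP; rewrite mulf_eq0 => /orP[|/eqP ->]; last by rewrite cabs0 ltxx.
by rewrite -[0]/(0%:C) (inj_eq (@complexI R)) gt_eqF.
Qed.

Lemma convex_hull_separation : compact S -> S !=set0 ->
  exists u : C, exists d : R, [/\ cabs u = 1, 0 < d &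
    forall w, S w -> d <= complex.Re (u * (w - z))].
Proof.
move=> cS S0; have [v hv] := positive_direction cS S0.
have [w0 Sw0 H0] : exists2 x, S x & forall a, S a -> dot v (x - z) <= dot v (a - z).
  apply: (@compact_total_max C S (fun a b => dot v (b - z) <= dot v (a - z))) => //.
  - move=> a Sa; apply: (@closed_comp C R _ [set s | s <= dot v (a - z)]); last exact: closed_le.
    move=> b _; rewrite (_ : (fun b => dot v (b - z)) = fun b =>
       complex.Re v * complex.Re b + (complex.Im v * complex.Im b - dot v z)).
      exact: cts_lin_ReIm.
    by apply/funext => {}b; rewrite /dot; case: (b) => ? ?; case: (z) => ? ? /=; ring.
  - by move=> a b _ _; case: (lerP (dot v (b - z)) (dot v (a - z))) => h; [left|right; exact: ltW].
  - by move=> a b c _ _ _ ab bc; exact: le_trans bc ab.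
have v0 : 0 < cabs v.
  rewrite cabs_gt0; apply/negP => /eqP v0; have := hv _ Sw0.
  by rewrite v0 /dot/= !mul0r addr0 ltxx.
(* The real part of [v^* x] is [dot v x], and [w0] minimizes this form over [S]; dividing by
   [cabs v] normalizes [u]. *)
exists (((cabs v)^-1)%:C * v^*%C), ((cabs v)^-1 * dot v (w0 - z)); split.
- rewrite cabsM cabs_real ger0_norm ?invr_ge0 ?ltW// (cabs_conj v) mulVf// gt_eqF//.
- by rewrite mulr_gt0 ?invr_gt0//; exact: hv.
- move=> w /H0 hw; rewrite (_ : complex.Re _ = (cabs v)^-1 * dot v (w - z)).
    by rewrite ler_wpM2l// invr_ge0 ltW.
  by rewrite /dot; case: (v) => ? ?; case: (w - z) => ? ? /=; ring.
Qed.

End OutsidePoint.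
End Separation.

(** * Uniform separation on compact subsets of the sphere *)

Section UniformSeparation.
Variable R : realType.
Local Notation C := R[i].
Implicit Types (S : set C) (u w z : C) (A d M : R).

(** Only the quotient [M / d] enters the estimate of [q_n / p_n]. Unlike [d] and [M] themselves, it
    can be bounded by one [A] up to infinity. *)
Definition separated_from S A z := exists u d M, [/\ cabs u = 1, 0 < d,
  forall w, S w -> d <= complex.Re (u * (w - z)),
  forall w, S w -> cabs (w - z) <= M & M <= A * d].

Lemma sphere_separation S (K : set (sphere R)) : compact S -> S !=set0 -> compact K ->
  K `<=` ~` (@to_sphere R @` convex_hull S) ->
  exists2 A, 0 < A & forall z, K (Some z) -> separated_from S A z.
Proof.
move=> cS S0 cK KS; have [B B0 HB] := compact_cabs_bounded cS.
pose P A (x : sphere R) := if x is Some z then separated_from S A z else True.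
suff : \forall A \near +oo, K `<=` P A.
  move=> [A0 [_ hA]]; exists (Num.max A0 0 + 1).
    by rewrite ltr_wpDl// le_max lexx orbT.
  move=> z Kz; have := hA (Num.max A0 0 + 1); rewrite ltr_pwDr// ?le_max ?lexx//.
  by move=> /(_ erefl _ Kz).
(* By compactness it suffices to find, around each point of [K], a neighbourhood on which all large
   [A] are suitable. *)
apply: (compact_near_coveringP K).1 => // -[z0|] Kz0.
  have z0S : ~ convex_hull S z0 by move=> hz; apply: (KS _ Kz0); exists z0.
  have [u [d [u1 d0 hd]]] := convex_hull_separation z0S cS S0.
  (* Moving [z0] by less than [d / 2] costs less than [d / 2] of the gap and keeps the same
     direction [u]. *)
  have d20 : 0 < d / 2 by rewrite divr_gt0.
  pose M := B + cabs z0 + d / 2.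
  have M0 : 0 < M by rewrite /M; have := cabs_ge0 z0; lra.
  exists ((Some @` [set z | cabs (z - z0) < d / 2]), [set A | M / (d / 2) < A]).
    split => /=.
      by apply: one_point_compactification_some_nbhs; exact: near_cabs.
    by exists (M / (d / 2)); split; [exact: num_real|].
  move=> [_ A] [/= [z zz0 <-] AM] /=; exists u, (d / 2), M; split => //.
  - move=> w Sw; have := hd _ Sw.
    have -> : w - z0 = (w - z) + (z - z0) by rewrite addrA subrK.
    have := Re_le_cabs (u * (z - z0)); rewrite cabsM u1 mul1r ler_norml => /andP[_].
    rewrite [u * (_ + (z - z0))]mulrDr (raddfD (@complex.Re R : Rcomplex R -> R)) /=.
    by have := zz0; lra.
  - move=> w Sw; have -> : w - z = (w + - z0) + (z0 - z) by rewrite addrA subrK.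
    have := le_cabsD (w - z0) (z0 - z); have := le_cabsD w (- z0); have := HB _ Sw.
    by rewrite cabsN (cabsC z0 z) /M; lra.
  - by rewrite -ler_pdivrMr// ltW.
(* With [S] in the disc of radius [B], the direction from [z] to the origin gives the gap [|z| - B]
   and the distance bound [|z| + B], whose quotient is below 2 exactly when [|z| > 3 B]. *)
exists ((Some @` (~` [set z : C | cabs z <= 3 * B])) `|` [set None], [set A | 2 < A]).
  split => /=; last by exists 2; split; [exact: num_real|].
  exists [set z : C | cabs z <= 3 * B] => //; split; first exact: compact_disc.
  by apply: (@closed_comp C R (@cabs R) [set x | x <= 3 * B]) => [z _|];
    [exact: cts_cabs|exact: closed_le].
move=> [_ A] [/= [[z /negP + <-]|->//] A2] /=; rewrite -ltNge => zB.
have z0 : 0 < cabs z by lra.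
exists (- ((cabs z)^-1)%:C * z^*), (cabs z - B), (cabs z + B); split.
- by rewrite cabsM cabsN cabs_real cabs_conj ger0_norm ?invr_ge0 ?(ltW z0)// mulVf// gt_eqF.
- lra.
- move=> w Sw; rewrite mulrBr (raddfB (@complex.Re R : Rcomplex R -> R)) /=.
  have -> : complex.Re (- ((cabs z)^-1)%:C * z^* * z) = - cabs z.
    have -> : - ((cabs z)^-1)%:C * z^* * z = (- (cabs z)^-1 * (cabs z) ^+ 2)%:C.
      by rewrite cabs_sqr; case: (z) => ? ?; apply/eqP; rewrite eq_complex/=; apply/andP; split; apply/eqP; ring.
    by rewrite /=; field; rewrite gt_eqF.
  have := Re_le_cabs (- ((cabs z)^-1)%:C * z^* * w).
  have zV : 0 <= (cabs z)^-1 by rewrite invr_ge0 ltW.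
  rewrite !cabsM cabsN cabs_real cabs_conj (ger0_norm zV) mulVf ?gt_eqF// mul1r.
  by have := HB _ Sw; rewrite ler_norml => ? /andP[]; lra.
- by move=> w Sw; have := HB _ Sw; have := le_cabsD w (- z); rewrite cabsN; lra.
- have : 0 <= (A - 2) * (cabs z - B) by rewrite mulr_ge0//; lra.
  lra.
Qed.

End UniformSeparation.

(** * From vanishing averages to sets of density one *)

Section Density.
Variable R : realType.
Implicit Types (x L a e : nat -> R).

Lemma count_mul_le_sum (s : seq nat) (P : pred nat) x (c : R) :
  (forall i, 0 <= x i) -> (forall i, i \in s -> P i -> c <= x i) ->
  (count P s)%:R * c <= \sum_(i <- s) x i.
Proof.
move=> x0; elim: s => [|i s ih] hc; first by rewrite big_nil mul0r.
rewrite big_cons /= natrD mulrDl lerD//.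
  case: (boolP (P i)) => Pi; last by rewrite mul0r.
  by rewrite mul1r hc// mem_head.
by apply: ih => j js; apply: hc; rewrite inE js orbT.
Qed.

(** Suprema of the tails, plus [1 / (n + 1)] to make them positive, since the square root of the
    majorant is later cancelled. *)
Lemma decreasing_majorant a : (forall n, 0 <= a n) -> a n @[n --> \oo] --> 0 ->
  exists e : nat -> R, [/\ forall n, 0 < e n, {homo e : i j / (i <= j)%N >-> j <= i},
    e n @[n --> \oo] --> 0 & forall n, a n <= e n].
Proof.
move=> ap a0; pose A n := [set a j | j in [set j | (n <= j)%N]].
have [M HM] : exists M, forall n, a n <= M.
  have /cvg_seq_bounded[M [_ HM]] : cvgn a by apply/cvg_ex; exists 0.
  exists (M + 1) => n; apply: le_trans (ler_norm _) _; apply: HM => //.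
  by rewrite ltrDl.
have hA n : has_sup (A n).
  split; first by exists (a n), n => //=.
  by exists M => _ [j _ <-]; exact: HM.
have leA n j : (n <= j)%N -> a j <= sup (A n).
  by move=> nj; apply: sup_upper_bound => //; exists j.
have cv0 : sup (A n) @[n --> \oo] --> 0.
  apply/cvgrPdist_le => eps eps0; move/cvgrPdist_le : a0 => /(_ eps eps0)[n0 _ H].
  exists n0 => // n /= n0n; rewrite sub0r normrN ler_norml; apply/andP; split.
    have := H n n0n; rewrite /= sub0r normrN ler_norml => /andP[+ _].
    by move=> /le_trans; apply; exact: leA.
  apply: ge_sup; first by have [] := hA n.
  move=> _ [j /= nj <-]; have := H j (leq_trans n0n nj).
  by rewrite /= sub0r normrN ler_norml => /andP[].
exists (fun n => sup (A n) + n.+1%:R^-1); split.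
- by move=> n; rewrite ltr_wpDl// ?(le_trans (ap n))// ?leA// invr_gt0.
- move=> i j ij; apply: lerD; last by rewrite lef_pV2 ?posrE// ler_nat.
  apply: ge_sup; first by have [] := hA j.
  by move=> _ [k /= jk <-]; apply: leA; exact: leq_trans jk.
- rewrite -[X in _ --> X]addr0; apply: cvgD; last exact: cvg_harmonic.
  exact: cv0.
- by move=> n; rewrite (le_trans (leA n n (leqnn n)))// lerDl.
Qed.

(** One direction of the Koopman-von Neumann lemma. With [e] a decreasing majorant of the averages,
    [N] is the set where [x n <= sqrt (e n)]. An exception [i <= n] has [x i >= sqrt (e n)] since
    [e] decreases, and the sum is at most [n e n], so there are at most [n sqrt (e n)]
    exceptions. *)
Lemma density_one_small x : (forall n, 0 <= x n) ->
  (\sum_(i <- iota 1 n) x i) / n%:R @[n --> \oo] --> 0 ->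
  exists N : set nat, density_one R N /\
    forall eps : R, 0 < eps -> exists n0, forall n, (n0 <= n)%N -> N n -> x n <= eps.
Proof.
move=> x0 /decreasing_majorant[n|e [e0 ed ec ae]].
  by rewrite divr_ge0// sumr_ge0.
pose N := [set n | x n <= Num.sqrt (e n)].
have sc : Num.sqrt (e n) @[n --> \oo] --> 0.
  have := @sqrt_continuous R 0; rewrite /continuous_at sqrtr0; exact: cvg_comp.
exists N; split; last first.
  move=> eps eps0; move/cvgrPdist_le : sc => /(_ eps eps0)[n0 _ H].
  exists n0 => n n0n Nn; apply: le_trans Nn _; have := H n n0n.
  by rewrite /= sub0r normrN ger0_norm ?sqrtr_ge0.
rewrite /density_one.
have hb n : (0 < n)%N -> 1 - Num.sqrt (e n) <= (count [in N] (iota 1 n))%:R / n%:R <= (1 : R).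
  move=> n0; have n0R : (0 : R) < n%:R by rewrite ltr0n.
  have := count_predC [in N] (iota 1 n); rewrite size_iota => cE.
  apply/andP; split; last first.
    by rewrite ler_pdivrMr// mul1r ler_nat -{2}cE leq_addr.
  rewrite ler_pdivlMr//.
  have h : (count (predC [in N]) (iota 1 n))%:R * Num.sqrt (e n) <= \sum_(i <- iota 1 n) x i.
    apply: count_mul_le_sum => // i; rewrite mem_iota add1n ltnS => /andP[_ i_n] /=.
    rewrite notin_setE /N/= => /negP; rewrite -ltNge => /ltW; apply: le_trans.
    by rewrite ler_wsqrtr// ed.
  have {h} : (count (predC [in N]) (iota 1 n))%:R * Num.sqrt (e n) <= n%:R * Num.sqrt (e n) ^+ 2.
    by apply: le_trans h _; rewrite sqr_sqrtr ?(ltW (e0 n))// mulrC -ler_pdivrMr//.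
  rewrite expr2 mulrA ler_pM2r ?sqrtr_gt0// => h.
  have : n%:R = (count [in N] (iota 1 n))%:R + (count (predC [in N]) (iota 1 n))%:R :> R.
    by rewrite -natrD cE.
  by rewrite mulrBl mul1r; lra.
apply: (@squeeze_cvgr _ _ _ _ (fun n => 1 - Num.sqrt (e n)) (cst 1)).
- by exists 1%N => // n /= n0; exact: hb.
- by rewrite -[X in _ --> X]subr0; apply: cvgB => //; exact: cvg_cst.
- exact: cvg_cst.
Qed.

(* The sum of the increments [L n - L (n - m)] telescopes, up to the [m] last
   values of [L]. *)
Lemma density_one_increments L m : (0 < m)%N ->
  (forall n, (m <= n)%N -> L (n - m)%N <= L n) ->
  (forall eps : R, 0 < eps -> exists n0, forall n, (n0 <= n)%N -> L n <= eps * n%:R) ->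
  exists N : set nat, density_one R N /\
    forall eps : R, 0 < eps -> exists n0, forall n, (n0 <= n)%N -> (m <= n)%N -> N n ->
      L n - L (n - m)%N <= eps.
Proof.
move=> m0 Lm Le.
pose x n := if (m <= n)%N then L n - L (n - m)%N else 0.
have x0 n : 0 <= x n by rewrite /x; case: ifPn => // mn; rewrite subr_ge0 Lm.
pose H k := \sum_(j < m) L (k + j)%N.
have HS k : H k.+1 = H k + x (m + k)%N.
  rewrite /x leq_addr addKn /H; case: m m0 {Lm x x0 H} => // m _.
  rewrite big_ord_recr [in RHS]big_ord_recl/= addn0.
  rewrite (eq_bigr (fun i : 'I_m => L (k + bump 0 i)%N)); last first.
    by move=> i _; rewrite /bump leq0n add1n addSnnS.
  by rewrite addSnnS (addnC m.+1); ring.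
have xE k : \sum_(i < k) x (m + i)%N = H k - H 0%N.
  elim: k => [|k ih]; first by rewrite big_ord0 subrr.
  by rewrite big_ord_recr/= ih HS; ring.
have sE n : (m <= n)%N -> \sum_(i <- iota 1 n) x i = H (n - m).+1 - H 0%N.
  move=> mn; rewrite -xE.
  have -> : iota 1 n = index_iota 1 n.+1 by rewrite /index_iota subn1.
  rewrite (@big_cat_nat _ _ _ m)//=; last exact: leqW.
  rewrite big_nat big1 ?add0r => [|i /andP[_ im]]; last by rewrite /x leqNgt im.
  rewrite -{1}[m]add0n big_addn big_mkord subSn//.
  by apply: eq_bigr => i _; rewrite addnC.
have [] := @density_one_small x x0; last first.
  move=> N [dN hN]; exists N; split => // eps /hN[n0 h]; exists n0 => n n0n mn Nn.
  by have := h n n0n Nn; rewrite /x mn.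
apply/cvgrPdist_le => eps eps0.
have m0R : (0 : R) < m%:R by rewrite ltr0n.
have em0 : 0 < eps / 2 / m%:R by rewrite !divr_gt0.
have [n0 hn0] := Le _ em0.
have [n1 hn1] : exists n1 : nat, 2 * `|H 0%N| / eps <= n1%:R.
  by exists (Num.bound (2 * `|H 0%N| / eps)); rewrite ltW// archi_boundP// divr_ge0 ?mulr_ge0// ltW.
(* From here on, the [m] indices in [H (n - m).+1] lie between [n0] and [n], and the fixed [H 0] is
   at most half of [eps * n] in absolute value. *)
exists (n0 + m + n1).+1 => // n /= nn.
have nR : (0 : R) < n%:R by rewrite ltr0n; exact: leq_trans nn.
rewrite sub0r normrN ger0_norm; last by rewrite divr_ge0// sumr_ge0.
rewrite ler_pdivrMr// sE; last by lia.
have hH : H (n - m).+1 <= eps / 2 * n%:R.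
  have -> : eps / 2 * n%:R = \sum_(j < m) (eps / 2 / m%:R * n%:R).
    by rewrite sumr_const card_ord -mulr_natl; field; rewrite gt_eqF.
  apply: ler_sum => j _; apply: le_trans (hn0 _ _) _; first by lia.
  rewrite ler_wpM2l ?divr_ge0 ?(ltW eps0)// ler_nat; have := ltn_ord j; lia.
have : `|H 0%N| <= eps / 2 * n%:R.
  have : 2 * `|H 0%N| / eps <= n%:R by apply: le_trans hn1 _; rewrite ler_nat; lia.
  by rewrite ler_pdivrMr//; lra.
by have := ler_norm (- H 0%N); rewrite normrN; lra.
Qed.

End Density.

(** * Ratio asymptotics for a monic polynomial bounded by 1 on the support *)

Section RatioAsymptotics.
Variable R : realType.
Local Notation C := R[i].
Variable mu : {finite_measure set C -> \bar R}.
Hypothesis mu_compact : compact (msupp mu).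
Local Notation S := (msupp mu).
Variable p : nat -> {poly C}.
Hypothesis hp : orthonormal_polys mu p.
Variables (f : {poly C}) (m : nat).
Hypothesis f_monic : f \is monic.
Hypothesis size_f : size f = m.+1.
Hypothesis f_le1 : forall w, S w -> cabs f.[w] <= 1.

(** The increment bound gives [r_n >= exp (- delta) >= 1 - delta], whence the first term, and
    [|q_n|^2 <= 1 - r_n^2 <= 2 (1 - r_n) <= 2 delta] in [L^2(mu)]. The factor [A] is the bound of
    [M / d]. *)
Lemma ratio_bound (A delta : R) n z : (0 < n)%N -> (m <= n)%N -> 0 < A ->
  separated_from S A z -> ln (kappa p n) - ln (kappa p (n - m)) <= delta ->
  cabs ((f * p (n - m)%N).[z] / (p n).[z] - 1) <= delta + A * Num.sqrt (2 * delta).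
Proof.
move=> n0 mn A0 [u [d [M [u1 d0 hd hM MA]]]] lk.
have k0 := kratio_gt0 hp m n; have k1 := kratio_le1 mu_compact hp f_monic size_f f_le1 mn.
have kd : 1 - kratio p m n <= delta.
  have : kratio p m n = expR (- (ln (kappa p n) - ln (kappa p (n - m)))).
    by rewrite opprB -ln_div ?posrE ?(kappa_gt0 hp)// lnK// posrE.
  move=> kE; have := expR_ge1Dx (- (ln (kappa p n) - ln (kappa p (n - m)))).
  by rewrite -kE; lra.
have pz0 := horner_orthonormal_neq0 mu_compact hp n0 u1 d0 hd.
have := kratio_remainder mu_compact hp f_monic size_f f_le1 mn.
have := size_remainder hp f_monic size_f mn.
have fE : f * p (n - m)%N = (kratio p m n)%:C *: p n + remainder p f m n.
  by rewrite addrC subrK.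
rewrite fE; set q := remainder p f m n => sq hq.
have bd := lower_degree_bound mu_compact hp sq u1 d0 hd hM.
rewrite hornerD hornerZ mulrDl mulfK//.
have -> : (kratio p m n)%:C + q.[z] / (p n).[z] - 1 = (kratio p m n - 1)%:C + q.[z] / (p n).[z].
  by rewrite rmorphB/= addrAC.
apply: le_trans (le_cabsD _ _) _; apply: lerD.
  by rewrite cabs_real distrC ger0_norm ?subr_ge0.
have c0 : 0 < cabs (p n).[z] by rewrite cabs_gt0.
rewrite cabsM cabsV ler_pdivrMr// -(@ler_pXn2r _ 2)// ?nnegrE ?cabs_ge0//; last first.
  by rewrite !mulr_ge0 ?sqrtr_ge0// ltW.
rewrite !exprMn sqr_sqrtr; last by rewrite mulr_ge0//; lra.
have d20 : 0 < d ^+ 2 by exact: exprn_gt0.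
rewrite -(ler_pM2l d20); apply: le_trans bd _.
have -> : d ^+ 2 * (A ^+ 2 * (2 * delta) * cabs (p n).[z] ^+ 2) =
          (A * d) ^+ 2 * (cabs (p n).[z] ^+ 2 * (2 * delta)) by ring.
(* The sign of [M] is known only from a point of the support; if there is none, the norm of [q]
   vanishes. *)
have [S0|/set0P[w Sw]] := eqVneq S set0.
  have -> : nrm2 mu q = 0.
    by rewrite /nrm2 Rintegral_supp// ?S0 ?Rintegral_set0//; exact: cts_cabs2.
  by rewrite !mulr0 !mulr_ge0 ?sqr_ge0//; lra.
have M0 : 0 <= M by apply: le_trans (hM _ Sw); exact: cabs_ge0.
apply: ler_pM.
- exact: sqr_ge0.
- by apply: mulr_ge0; [exact: sqr_ge0|exact: nrm2_ge0].
- by rewrite lerXn2r// nnegrE// mulr_ge0// ltW.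
- apply: ler_wpM2l; first exact: sqr_ge0.
  have : 0 <= (1 - kratio p m n) ^+ 2 by exact: sqr_ge0.
  by nra.
Qed.

Lemma uniform_ratio : (0 < m)%N -> S !=set0 ->
  (forall eps : R, 0 < eps -> exists n0, forall n, (n0 <= n)%N -> ln (kappa p n) <= eps * n%:R) ->
  exists N : set nat, density_one R N /\
    forall K : set (sphere R), compact K ->
      K `<=` ~` (@to_sphere R @` convex_hull S) ->
      {uniform K, (fun n => sphere_quot (f * p (n - m)%N) (p n))
                    @ within N \oo --> cst (1 : C)}.
Proof.
move=> m0 S0 hk.
have Lm n : (m <= n)%N -> ln (kappa p (n - m)) <= ln (kappa p n).
  move=> mn; rewrite ler_ln ?posrE ?(kappa_gt0 hp)//.
  by have := kratio_le1 mu_compact hp f_monic size_f f_le1 mn;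
    rewrite /kratio ler_pdivrMr ?(kappa_gt0 hp)// mul1r.
have [N [dN hN]] := @density_one_increments R (fun n => ln (kappa p n)) m m0 Lm hk.
exists N; split => // K cK KS.
have [A A0 hA] := sphere_separation mu_compact S0 cK KS.
move=> P /uniform_nbhs[E [entE EP]].
have [eps eps0 hE] : exists2 eps : R, 0 < eps & forall z : C, cabs (z - 1) < eps -> E (1, z).
  have /nbhs_cabsP[eps eps0 h] : nbhs (1 : C) (xsection E 1) by exact: nbhs_entourage.
  by exists eps => // z /h; rewrite /xsection/= inE.
(* The first entry keeps [delta] below [eps / 4], the second keeps [A * sqrt (2 * delta)] below
   [eps / 2], as [sqrt 2 <= 2]. *)
pose delta := Num.min (eps / 4) ((eps / (4 * A)) ^+ 2).
have dl0 : 0 < delta by rewrite /delta lt_min !(divr_gt0, exprn_gt0)// mulr_gt0.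
have dl1 : delta + A * Num.sqrt (2 * delta) < eps.
  have d1 : delta <= eps / 4 by rewrite /delta ge_min lexx.
  have d2 : delta <= (eps / (4 * A)) ^+ 2 by rewrite /delta ge_min lexx orbT.
  have s2 : Num.sqrt (2 * delta) <= 2 * (eps / (4 * A)).
    have eA : 0 <= 2 * (eps / (4 * A)) by rewrite mulr_ge0// divr_ge0// ?mulr_ge0// ltW.
    rewrite -(ger0_norm eA).
    rewrite -sqrtr_sqr; apply: ler_wsqrtr.
    by have := sqr_ge0 (eps / (4 * A)); rewrite [(2 * _) ^+ 2]exprMn; lra.
  have := ler_wpM2l (ltW A0) s2.
  have -> : A * (2 * (eps / (4 * A))) = eps / 2 by field; rewrite gt_eqF.
  lra.
have [n0 h0] := hN delta dl0.
exists (maxn n0 m); first by [].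
move=> n /=; rewrite geq_max => /andP[n0n mn] Nn.
apply: EP => -[z|] Kz; apply: hE.
  apply: le_lt_trans dl1; apply: ratio_bound => //; first exact: leq_trans mn.
  - exact: hA.
  - exact: h0.
(* At infinity both polynomials have degree [n], and the quotient is exactly [r_n]. *)
rewrite /sphere_quot (size_orthonormal hp)/= (coef_f_mul hp f_monic size_f mn) (coef_orthonormal hp).
have -> : (kappa p (n - m))%:C / (kappa p n)%:C - 1 = (kratio p m n - 1)%:C.
  by rewrite rmorphB/= /kratio rmorphM/= fmorphV.
have k1 := kratio_le1 mu_compact hp f_monic size_f f_le1 mn.
rewrite cabs_real distrC ger0_norm ?subr_ge0//; apply: le_lt_trans dl1.
have kE : kratio p m n = expR (- (ln (kappa p n) - ln (kappa p (n - m)))).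
  by rewrite opprB -ln_div ?posrE ?(kappa_gt0 hp)// lnK// posrE; exact: (kratio_gt0 hp).
have := expR_ge1Dx (- (ln (kappa p n) - ln (kappa p (n - m)))).
rewrite -kE; have := h0 n n0n mn Nn; have := mulr_ge0 (ltW A0) (sqrtr_ge0 (2 * delta)).
lra.
Qed.

End RatioAsymptotics.

(** * The logarithmic potential of the circle, at points outside the disc *)

Section CircleMean.
Variable R : realType.
Local Notation C := R[i].
Notation leb := (@lebesgue_measure R).
Implicit Types (G : R -> R) (z : C) (s t : R).

Lemma continuous_itv_integrable G (a b : R) : continuous G ->
  leb.-integrable `[a, b] (EFin \o G).
Proof.
move=> cG; apply: continuous_compact_integrable; first exact: segment_compact.
exact: continuous_subspaceT.
Qed.

Lemma Rintegral_affine_half G c : continuous G ->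
  \int[leb]_(s in `[c, c + 2^-1]) G s = 2^-1 * \int[leb]_(s in `[0, 1]) G (s / 2 + c).
Proof.
move=> cG; pose F (s : R) := s / 2 + c.
have F0 : F 0 = c by rewrite /F mul0r add0r.
have F1 : F 1 = c + 2^-1 by rewrite /F mul1r addrC.
have dF : derive1 F = cst 2^-1.
  apply/funext => s; rewrite derive1E /F; apply: derive_val.
  by apply: is_derive_eq; rewrite !scaler0 add0r addr0 [_%:A]mulr1.
have cF : continuous F.
  by move=> s; apply: cvgD; [apply: cvgM; [exact: cvg_id|exact: cvg_cst]|exact: cvg_cst].
have cGF : continuous (G \o F) by move=> s; apply: continuous_comp; [exact: cF|exact: cG].
rewrite -RintegralZl//; last exact: continuous_itv_integrable.
rewrite /Rintegral -{1}F0 -F1; congr fine.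
rewrite (@integration_by_substitution_increasing R F G 0 1) //.
- by rewrite dF; apply: eq_integral => s _; rewrite /= mulrC.
- by move=> x y _ _ xy; rewrite /F ltrD2r ltr_pM2r// invr_gt0.
- by rewrite dF => s _; exact: cst_continuous.
- by rewrite dF; exact: is_cvg_cst.
- by rewrite dF; exact: is_cvg_cst.
- split; first by move=> s _; apply: derivableD.
  + exact: cvg_at_right_filter (cF 0).
  + exact: cvg_at_left_filter (cF 1).
- exact: continuous_subspaceT.
Qed.

(** The parameters [s / 2] and [s / 2 + 1 / 2] give opposite points of the circle, the two square
    roots of the point of parameter [s]. *)
Lemma Rintegral_halves G : continuous G ->
  \int[leb]_(s in `[0, 1]) G s =
  2^-1 * \int[leb]_(s in `[0, 1]) (G (s / 2 + 0) + G (s / 2 + 2^-1)).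
Proof.
move=> cG.
have cH c : continuous (fun s => G (s / 2 + c)).
  move=> s; apply: (@continuous_comp _ _ _ (fun s : R => s / 2 + c) G); last exact: cG.
  by apply: cvgD; [apply: cvgM; [exact: cvg_id|exact: cvg_cst]|exact: cvg_cst].
rewrite RintegralD//; try exact: (continuous_itv_integrable 0 1 (cH _)).
rewrite mulrDr -!Rintegral_affine_half// add0r (_ : 2^-1 + 2^-1 = 1); last by lra.
have := @Rintegral_itvB R G (BLeft 0) (BRight 1) 2^-1 (continuous_itv_integrable 0 1 cG).
rewrite !bnd_simp => /(_ _ _)/eqP; rewrite subr_eq addrC => /(_ _ _)/eqP -> //; try lra.
congr (_ + _); rewrite Rintegral_itv_obnd_cbnd//.
apply: integrableS (continuous_itv_integrable 0 1 cG) => //.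
by apply: subset_itvr; rewrite bnd_simp; lra.
Qed.

Definition cis s : C := (cos s +i* sin s)%C.

Lemma cisD s t : cis (s + t) = cis s * cis t.
Proof.
rewrite /cis cosD sinD; apply/eqP; rewrite eq_complex/=; apply/andP.
by split; apply/eqP; ring.
Qed.

Lemma cisX s n : cis s ^+ n = cis (n%:R * s).
Proof.
elim: n => [|n ih]; first by rewrite expr0 mul0r /cis cos0 sin0.
by rewrite exprS ih -cisD -natr1; congr cis; ring.
Qed.

Lemma cabs_cis s : cabs (cis s) = 1.
Proof. by rewrite cabsE/= cos2Dsin2 sqrtr1. Qed.

Lemma cts_cis : continuous cis.
Proof. exact: cts_complex (@continuous_cos R) (@continuous_sin R). Qed.

Definition circ t : C := cis (2 * pi * t).

Lemma cabs_circ t : cabs (circ t) = 1. Proof. exact: cabs_cis. Qed.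

Lemma cts_circ : continuous circ.
Proof.
move=> t; apply: (@continuous_comp _ _ _ (fun t => 2 * pi * t) cis); last exact: cts_cis.
by apply: cvgM; [exact: cvg_cst|exact: cvg_id].
Qed.

Lemma circ_half t : circ (t / 2 + 0) ^+ 2 = circ t.
Proof. by rewrite /circ cisX; congr cis; field. Qed.

Lemma circ_half_opp t : circ (t / 2 + 2^-1) = - circ (t / 2 + 0).
Proof.
have -> : - circ (t / 2 + 0) = circ (t / 2 + 0) * cis pi.
  by rewrite /cis cospi sinpi; apply/eqP; rewrite eq_complex/=; apply/andP; split; apply/eqP; ring.
by rewrite /circ -cisD; congr cis; field.
Qed.

Definition lnpot z t : R := - ln (cabs (z - circ t)).
Definition circle_mean z : R := \int[leb]_(t in `[0, 1]) lnpot z t.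

Lemma cabs_sub_circ z t : cabs z - 1 <= cabs (z - circ t) <= cabs z + 1.
Proof.
have := le_cabs_dist z (circ t); have := le_cabsD z (- circ t).
by rewrite cabsN cabs_circ ler_norml => ? /andP[? ?]; apply/andP; split; lra.
Qed.

Lemma cts_cabs_sub_circ z : continuous (fun t => cabs (z - circ t)).
Proof.
move=> t; apply: (@continuous_comp _ _ _ circ (fun w => cabs (z - w))).
  exact: cts_circ.
by apply: lipschitz_cts => v w; apply: le_trans (le_cabs_dist _ _) _;
  rewrite cabsC (_ : _ - _ - _ = v - w)//; ring.
Qed.

Lemma cts_lnpot z : 1 < cabs z -> continuous (lnpot z).
Proof.
move=> z1 t; apply: cvgN; apply: (@continuous_comp _ _ _ (fun t => cabs (z - circ t)) (@ln R)).
  exact: cts_cabs_sub_circ.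
by apply: continuous_ln; have /andP[+ _] := cabs_sub_circ z t; lra.
Qed.

(** For [a] on the circle, [z^2 - a^2 = (z - a) (z + a)]; the logarithms of the two factors
    integrate to the two halves of the mean at [z]. *)
Lemma circle_mean_sqr z : 1 < cabs z -> circle_mean (z ^+ 2) = 2 * circle_mean z.
Proof.
move=> z1; rewrite /circle_mean (Rintegral_halves (cts_lnpot z1)) mulrA divff// mul1r.
apply: eq_Rintegral => t _; rewrite /lnpot -opprD -lnM.
- rewrite -cabsM circ_half_opp -(circ_half t); congr (- ln (cabs _)); ring.
- by rewrite posrE; have /andP[+ _] := cabs_sub_circ z (t / 2 + 0); lra.
- by rewrite posrE; have /andP[+ _] := cabs_sub_circ z (t / 2 + 2^-1); lra.
Qed.

(* [circle_mean z] is half of [circle_mean (z ^+ 2)], and squaring repeatedly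
   makes the integrand negative. *)
Lemma circle_mean_le0 z : 1 < cabs z -> circle_mean z <= 0.
Proof.
(* At modulus at least 2, the distance to the circle is at least 1. *)
have base w : 2 <= cabs w -> circle_mean w <= 0.
  move=> w2; have w1 : 1 < cabs w by lra.
  rewrite -oppr_ge0 -mulN1r -RintegralZl//; last first.
    by apply: continuous_itv_integrable; exact: cts_lnpot.
  apply: Rintegral_ge0 => t _; rewrite mulN1r opprK ln_ge0//.
  by have /andP[+ _] := cabs_sub_circ w t; lra.
have iter k : forall w, 1 < cabs w -> 2 <= cabs w ^+ (2 ^ k) -> circle_mean w <= 0.
  elim: k => [|k ih] w w1 wk; first exact: base.
  have := ih (w ^+ 2); rewrite circle_mean_sqr// pmulr_rle0//; apply.
    by rewrite cabsX exprn_egt1.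
  by rewrite cabsX -exprM -expnS.
move=> z1; pose k := Num.bound (cabs z - 1)^-1.
apply: (iter k) => //.
have kb : (cabs z - 1)^-1 <= k%:R by rewrite ltW// archi_boundP// invr_ge0; lra.
have : 1 <= k%:R * (cabs z - 1) by rewrite -ler_pdivrMr ?div1r//; lra.
(* Bernoulli's inequality; at [k] the left side is at least 2, and [k <= 2 ^ k]. *)
have bern n : 1 + n%:R * (cabs z - 1) <= cabs z ^+ n.
  elim: n => [|n ih]; first by rewrite mul0r addr0 expr0.
  rewrite exprS -natr1; have := ler_pM _ _ (ltW z1) ih.
  have n0 : 0 <= n%:R * (cabs z - 1) by rewrite mulr_ge0//; lra.
  have := ler_wpM2l (cabs_ge0 z) ih; have := sqr_ge0 (cabs z - 1).
  by rewrite expr2 => h1 h2 _; have := mulr_ge0 (ler0n R n) h1; lra.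
have := bern k; have : cabs z ^+ k <= cabs z ^+ (2 ^ k).
  by rewrite ler_weXn2l// ?ltW// ltnW// ltn_expl.
lra.
Qed.

End CircleMean.

(** * The extended logarithmic kernel and the potential on the circle itself *)

Section LogPotential.
Variable R : realType.
Local Notation C := R[i].
Notation leb := (@lebesgue_measure R).
Implicit Types (z : C) (t b : R).

Definition nlne b : \bar R := (- lne b%:E)%E.

Lemma nlneE b : 0 < b -> nlne b = (- ln b)%:E.
Proof. by move=> b0; rewrite /nlne lne_EFin// EFinN. Qed.

Lemma nlne0 : nlne 0 = +oo%E.
Proof. by rewrite /nlne le0_lneNy. Qed.

Lemma measurable_nlne : measurable_fun setT nlne.
Proof.
have -> : nlne = fun b => if 0 < b then (- ln b)%:E else +oo%E.
  apply/funext => b; case: ifPn => b0; first exact: nlneE.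
  by rewrite /nlne le0_lneNy// lee_fin leNgt.
apply: measurable_fun_ifT => //.
- exact: measurable_fun_ltr.
- apply/measurable_EFinP; apply: measurableT_comp; first exact: oppr_measurable.
  exact: measurable_ln.
Qed.

Lemma nlne_le b c : b <= c -> (nlne c <= nlne b)%E.
Proof.
move=> bc; have [b0|b0] := ltP 0 b; last first.
  by rewrite [leRHS]/nlne le0_lneNy ?lee_fin//= leey.
have c0 : 0 < c by exact: lt_le_trans bc.
by rewrite !nlneE// lee_fin lerN2 ler_ln.
Qed.

Lemma cvg_nlne (u : nat -> R) b : (forall n, 0 < u n) -> 0 <= b ->
  u n @[n --> \oo] --> b -> (- ln (u n))%:E @[n --> \oo] --> nlne b.
Proof.
move=> u0; rewrite le_eqVlt => /predU1P[<-|b0] ub.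
  rewrite nlne0; apply/cvgeryP/cvgryPge => A.
  move/cvgrPdist_lt : ub => /(_ _ (expR_gt0 (- A)))[n0 _ H].
  exists n0 => // n n0n; have := H n n0n; rewrite /= sub0r normrN gtr0_norm//.
  by move=> uA; rewrite lerNr -[leRHS]expRK ler_ln ?posrE ?expR_gt0// ltW.
rewrite nlneE//; apply: cvg_EFin; first by exact: nearW.
apply: cvgN; apply: (@cvg_comp _ _ _ u (@ln R)); first exact: ub.
exact: continuous_ln.
Qed.

(** For [|z| <= 2] the distance to the circle is at most 3, so the shift makes the kernel
    nonnegative, as Fatou's lemma requires. *)
Definition lnpot3 z t : \bar R := (nlne (cabs (z - circ t)%R) + (ln 3)%:E)%E.

Lemma measurable_lnpot3 z : measurable_fun setT (lnpot3 z).
Proof.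
apply: emeasurable_funD; last exact: measurable_cst.
apply: measurableT_comp; first exact: measurable_nlne.
by apply: continuous_measurable_fun; exact: cts_cabs_sub_circ.
Qed.

Lemma lnpot3_ge0 z t : cabs z <= 2 -> (0 <= lnpot3 z t)%E.
Proof.
move=> z2; have : (nlne 3%R <= nlne (cabs (z - circ t)%R))%E.
  by apply: nlne_le; have /andP[_] := cabs_sub_circ z t; lra.
rewrite nlneE// EFinN => h; rewrite /lnpot3 -(@subee _ (ln 3)%:E)// addeC.
by rewrite leeD2r.
Qed.

(** Fatou's lemma along the points [w n = (1 + 1 / (n + 1)) z], which approach [z] from outside,
    where the mean is at most 0, and stay in the disc of radius 2. The kernels converge at every
    [t], to [+oo] where [circ t = z]. *)
Lemma integral_lnpot3 z : cabs z = 1 ->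
  (\int[leb]_(t in `[0%R, 1%R]) lnpot3 z t <= (ln 3)%:E)%E.
Proof.
move=> z1; pose r n : R := 1 + n.+1%:R^-1; pose w n := (r n)%:C * z.
have V0 n : 0 < n.+1%:R^-1 :> R by rewrite invr_gt0.
have V1 n : n.+1%:R^-1 <= 1 :> R by rewrite invf_le1// ler1n.
have wE n : cabs (w n) = r n.
  by rewrite /w cabsM z1 mulr1 cabs_real ger0_norm// addr_ge0// ltW.
have w1 n : 1 < cabs (w n) by rewrite wE /r ltrDl.
pose f n t := (lnpot (w n) t + ln 3)%:E.
have cf n : continuous (fun t => lnpot (w n) t + ln 3).
  by move=> t; apply: cvgD; [exact: cts_lnpot|exact: cvg_cst].
have bw t : cabs (w n - circ t) @[n --> \oo] --> cabs (z - circ t).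
  apply/cvgrPdist_le => e e0; have [n0 _ H] := (cvgrPdist_le _ _).1 (@cvg_harmonic R) e e0.
  exists n0 => // n n0n; have := H n n0n; rewrite /harmonic/= sub0r normrN ger0_norm ?(ltW (V0 n))//.
  apply: le_trans; apply: le_trans (le_cabs_dist _ _) _; rewrite cabsC.
  have -> : w n - circ t - (z - circ t) = (n.+1%:R^-1)%:C * z.
    by rewrite /w /r rmorphD/= rmorph1; ring.
  by rewrite cabsM z1 mulr1 cabs_real ger0_norm// ltW.
have fE t : limn_einf (f^~ t) = lnpot3 z t.
  have H : f^~ t @ \oo --> lnpot3 z t.
    rewrite /f /lnpot3; under eq_cvg do rewrite EFinD.
    apply: cvgeD; first by rewrite fin_num_adde_defl.
    - apply: (@cvg_nlne (fun n => cabs (w n - circ t))) => //; last exact: cabs_ge0.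
      by move=> n; have /andP[+ _] := cabs_sub_circ (w n) t; have := w1 n; lra.
    - exact: cvg_cst.
  by have [] := cvg_limn_einf_sup H.
have f0 n t : (0 <= f n t)%E.
  rewrite lee_fin /lnpot addrC subr_ge0 ler_ln ?posrE//.
    have r2 : r n <= 1 + 1 by rewrite lerD2l.
    by have /andP[_] := cabs_sub_circ (w n) t; rewrite wE; lra.
  by have /andP[+ _] := cabs_sub_circ (w n) t; have := w1 n; lra.
have mf n : measurable_fun (`[0, 1]%classic : set R) (f n).
  by apply/measurable_EFinP; apply: measurable_funTS; exact: continuous_measurable_fun.
have := @fatou _ _ _ leb (`[0, 1]%classic : set R) (measurable_itv _) f mf (fun n t _ => f0 n t).
under eq_integral do rewrite fE.
move=> /le_trans; apply; apply: le_trans (limn_einf_sup _) _.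
have If n : (\int[leb]_(t in `[0%R, 1%R]) f n t <= (ln 3)%:E)%E.
  have -> : (\int[leb]_(t in `[0%R, 1%R]) f n t)%E = (circle_mean (w n) + ln 3)%:E.
    have ii : leb.-integrable `[0%R, 1%R] (EFin \o (fun t => lnpot (w n) t + ln 3)).
      exact: continuous_itv_integrable.
    rewrite -[LHS]fineK ?integrable_fin_num//; congr EFin.
    rewrite -[LHS]/(\int[leb]_(t in `[0%R, 1%R]) (lnpot (w n) t + cst (ln 3) t)).
    rewrite RintegralD//; last 2 first.
    - by apply: continuous_itv_integrable; exact: cts_lnpot.
    - by apply: continuous_itv_integrable => t; exact: cst_continuous.
    rewrite Rintegral_cst//; congr (_ + _).
    by rewrite /= lebesgue_measure_itv/= lte_fin ltr01 oppr0 adde0/= mulr1.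
  by rewrite lee_fin gerDr circle_mean_le0.
rewrite limn_esup_lim; apply: lime_le.
  exact: is_cvg_esups.
apply: nearW => n; apply: ge_ereal_sup => _ [k _ <-]; exact: If.
Qed.

End LogPotential.

(** * Mixtures of image measures and tools for their energy *)

Section EnergyOfMixture.
Variable R : realType.
Local Notation C := R[i].
Notation leb := (@lebesgue_measure R).
Implicit Types (z w : C) (t : R).

(** [nu] is the average of the laws of the [X j] under a uniform variable on [[0, 1]]; the
    integration formula is all that is retained of it. *)
Lemma uniform_mixture m (X : nat -> R -> C) : (0 < m)%N ->
  (forall j, measurable_fun setT (X j)) ->
  exists nu : probability C R, forall f : C -> \bar R,
    measurable_fun setT f -> (forall z, (0 <= f z)%E) ->
    (\int[nu]_z f z =
     (m%:R^-1)%:E * \sum_(j < m) \int[leb]_(t in `[0%R, 1%R]) f (X j t))%E.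
Proof.
move=> m0 mX; pose P := uniform_prob (@ltr01 R).
have V0 : 0 <= m%:R^-1 :> R by rewrite invr_ge0.
pose Y j : {RV P >-> C} := HB.pack (X j : measurableTypeR R -> C)
  (@isMeasurableFun.Build _ _ (measurableTypeR R) C (X j) (mX j)).
pose nu0 : {measure set C -> \bar R} := msum (fun j => distribution P (Y j)) m.
pose nu1 : {measure set C -> \bar R} := mscale (NngNum V0) nu0.
have nu1T : nu1 setT = 1%E.
  rewrite /nu1 /= /mscale /nu0 /= /msum/=.
  rewrite (eq_bigr (fun=> 1%E)); last by move=> i _; rewrite probability_setT.
  by rewrite sumEFin -EFinM big_const_ord iter_addr_0 mulVf// pnatr_eq0 -lt0n.
pose nu : probability C R := HB.pack (mscale (NngNum V0) nu0)
  (Measure_isProbability.Build _ _ _ (mscale (NngNum V0) nu0) nu1T).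
exists nu => f mf f0.
transitivity (\int[nu1]_z f z)%E; first by [].
rewrite ge0_integral_mscale//=; congr (_ * _)%E.
rewrite ge0_integral_measure_sum//; apply: eq_bigr => j _.
rewrite ge0_integral_distribution// integral_uniform//=.
- by rewrite subr0 invr1 mul1e.
- exact: (measurableT_comp mf (mX j)).
Qed.

Lemma nlneM (x y : R) : 0 <= x -> 0 <= y -> nlne (x * y) = (nlne x + nlne y)%E.
Proof.
have ny b : 0 <= b -> nlne b != -oo%E.
  rewrite le_eqVlt => /predU1P[<-|b0]; first by rewrite nlne0.
  by rewrite nlneE.
move=> x0 y0; move: (x0) (y0); rewrite le_eqVlt => /predU1P[<- _|xp].
  by rewrite mul0r nlne0 addye// ny.
rewrite le_eqVlt => /predU1P[<-|yp]; first by rewrite mulr0 nlne0 addey// ny.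
by rewrite !nlneE ?mulr_gt0// lnM ?posrE// opprD EFinD.
Qed.

Lemma nlne_prod (I : Type) (s : seq I) (x : I -> R) : (forall i, 0 <= x i) ->
  (\sum_(i <- s) nlne (x i))%E = nlne (\prod_(i <- s) x i).
Proof.
move=> x0; elim: s => [|i s ih]; first by rewrite !big_nil nlneE// ln1 oppr0.
by rewrite !big_cons ih nlneM// prodr_ge0.
Qed.

Lemma measurable_nlne_dist z : measurable_fun setT (fun w => nlne (cabs (z - w))).
Proof.
apply: measurableT_comp; first exact: measurable_nlne.
apply: measurable_ctsC; apply: lipschitz_cts => v w.
apply: le_trans (le_cabs_dist _ _) _.
by rewrite cabsC (_ : _ - _ - _ = v - w)//; ring.
Qed.

Import HBNNSimple.

(** Stated for an arbitrary nonnegative [f], so as to apply to the positive part of a potential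
    without proving it measurable: the integral is a supremum over simple functions below [f], and
    each of these vanishes on [D]. *)
Lemma ge0_integral_ae0 (nu : {measure set C -> \bar R}) (D : set C) (f : C -> \bar R) :
  measurable D -> nu (~` D) = 0%E -> (forall z, (0 <= f z)%E) ->
  (forall z, D z -> f z = 0%E) -> (\int[nu]_z f z)%E = 0%E.
Proof.
move=> mD nD f0 fD; apply/eqP; rewrite eq_le integral_ge0// andbT.
have mCD := measurableC mD.
rewrite ge0_integralTE//; apply: ge_ereal_sup => _ [h /= hf <-].
rewrite -(integralT_nnsfun nu h).
rewrite (ge0_negligible_integral mCD)//; last 2 first.
- by apply/measurable_EFinP; exact: measurable_funPT.
- by move=> z _; rewrite lee_fin.
rewrite setTD setCK integral0_eq// => z Dz.
apply/eqP; rewrite eq_le; apply/andP; split; last by rewrite lee_fin.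
by rewrite -(fD z Dz).
Qed.

End EnergyOfMixture.

(** * A probability of nonpositive energy on the lemniscate *)

Section LemniscateEnergy.
Variable R : realType.
Local Notation C := R[i].
Notation leb := (@lebesgue_measure R).
Implicit Types (z w a : C) (t : R).

Definition lemniscate m : set C := [set z | cabs (z ^+ m - 1) = 1].

(** The [r j] are the [m]-th roots of unity, and the factorization of [X^m - 1] is made homogeneous
    in [a]. *)
Lemma subrX_factor m : (0 < m)%N ->
  exists r : nat -> C, forall z a, z ^+ m - a ^+ m = \prod_(j < m) (z - r j * a).
Proof.
move=> m0; have [s] := closed_field_poly_normal ('X^m - 1 : {poly C}).
rewrite lead_coefXnsubC// scale1r => sE.
have sm : size s = m.
  by have := size_XnsubC (1 : C) m0; rewrite sE (size_prod_XsubC s id) => -[].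
exists (nth 0 s) => z a.
have E y : y ^+ m - 1 = \prod_(j < m) (y - s`_j).
  rewrite -sm -(big_mkord xpredT (fun j => y - s`_j)) -(big_nth 0 xpredT (fun v => y - v)) sm.
  have := congr1 (horner^~ y) sE; rewrite !hornerE => ->.
  by rewrite horner_prod; apply: eq_bigr => v _; rewrite !hornerE.
have [->|a0] := eqVneq a 0.
  rewrite expr0n gtn_eqF//= subr0 (eq_bigr (fun=> z)); last by move=> j _; rewrite mulr0 subr0.
  by rewrite prodr_const card_ord.
transitivity (a ^+ m * ((z / a) ^+ m - 1)).
  by rewrite mulrBr mulr1 -exprMn mulrCA divff// mulr1.
have -> : a ^+ m = \prod_(j < m) a by rewrite prodr_const card_ord.
rewrite E -big_split/=.
by apply: eq_bigr => j _; rewrite mulrBr mulrCA divff// mulr1 mulrC.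
Qed.

(* The principal [m]-th root of [1 - circ t], which traces one petal. *)
Definition petal m t : C :=
  ((2 * sin (pi * t)) `^ m%:R^-1)%:C * cis (pi * (t - 2^-1) / m%:R).

(** In polar form, [1 - exp (2 pi i t) = 2 sin (pi t) exp (i pi (t - 1/2))], where the sine is
    nonnegative for [t] in [[0, 1]]. *)
Lemma petalX m t : (0 < m)%N -> 0 <= t <= 1 -> petal m t ^+ m = 1 - circ t.
Proof.
move=> m0 /andP[t0 t1]; have mn : m%:R != 0 :> R by rewrite pnatr_eq0 -lt0n.
have s0 : 0 <= 2 * sin (pi * t).
  apply: mulr_ge0 => //; apply: sin_ge0_pi.
  by rewrite mulr_ge0 ?pi_ge0//= ler_piMr// pi_ge0.
rewrite /petal exprMn cisX -rmorphXn/= -powR_mulrn ?powR_ge0// -powRrM mulVf// powRr1//.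
have -> : m%:R * (pi * (t - 2^-1) / m%:R) = pi * (t - 2^-1) :> R by field.
rewrite /circ /cis.
have -> : pi * (t - 2^-1) = pi * t - pi / 2 :> R by ring.
have -> : 2 * pi * t = pi * t + pi * t :> R by ring.
rewrite cosB sinB cosD sinD cos_pihalf sin_pihalf.
apply/eqP; rewrite eq_complex/=; apply/andP; split; apply/eqP; last by ring.
by have := cos2Dsin2 (pi * t : R); nra.
Qed.

Lemma measurable_petal m (r : C) : measurable_fun setT (fun t => r * petal m t).
Proof.
have mc k : continuous (fun t : R => pi * (t - k) / m%:R).
  by move=> t; apply: cvgM; [apply: cvgM; [exact: cvg_cst|
    apply: cvgB; [exact: cvg_id|exact: cvg_cst]]|exact: cvg_cst].
have ms : measurable_fun setT (fun t : R => (2 * sin (pi * t)) `^ m%:R^-1).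
  apply: (@measurableT_comp _ _ _ _ _ _ (fun x : R => x `^ m%:R^-1)).
    exact: measurable_powR.
  apply: continuous_measurable_fun => t; apply: cvgM; first exact: cvg_cst.
  apply: (@continuous_comp _ _ _ (fun t => pi * t) sin); last exact: continuous_sin.
  by apply: cvgM; [exact: cvg_cst|exact: cvg_id].
have mco : measurable_fun setT (fun t : R => cos (pi * (t - 2^-1) / m%:R)).
  apply: continuous_measurable_fun => t.
  by apply: (@continuous_comp _ _ _ (fun t => pi * (t - 2^-1) / m%:R) cos);
    [exact: mc|exact: continuous_cos].
have msi : measurable_fun setT (fun t : R => sin (pi * (t - 2^-1) / m%:R)).
  apply: continuous_measurable_fun => t.
  by apply: (@continuous_comp _ _ _ (fun t => pi * (t - 2^-1) / m%:R) sin);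
    [exact: mc|exact: continuous_sin].
case: r => x y; apply: measurable_complex.
  rewrite [X in measurable_fun _ X](_ : _ = fun t => (2 * sin (pi * t)) `^ m%:R^-1 *
    (x * cos (pi * (t - 2^-1) / m%:R) - y * sin (pi * (t - 2^-1) / m%:R))).
    by apply: measurable_funM => //; apply: measurable_funB; apply: measurable_funM.
  by apply/funext => t /=; ring.
rewrite [X in measurable_fun _ X](_ : _ = fun t => (2 * sin (pi * t)) `^ m%:R^-1 *
    (x * sin (pi * (t - 2^-1) / m%:R) + y * cos (pi * (t - 2^-1) / m%:R))).
  by apply: measurable_funM => //; apply: measurable_funD; apply: measurable_funM.
by apply/funext => t /=; ring.
Qed.

Lemma lemniscate_le2 m z : (0 < m)%N -> cabs (z ^+ m - 1) <= 1 -> cabs z <= 2.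
Proof.
move=> m0 z1; rewrite leNgt; apply/negP => z2.
have : 2 < cabs z ^+ m.
  by apply: (lt_le_trans z2); apply: ler_eXnr => //; apply: ltW; apply: lt_trans z2; rewrite ltr1n.
by have := le_cabsD (z ^+ m - 1) 1; rewrite subrK cabs1 cabsX; lra.
Qed.

Lemma closed_lemniscate m : closed (lemniscate m).
Proof.
have E : (fun z : C => cabs (z ^+ m - 1)) = @cabs R \o (horner ('X^m - 1)).
  by apply/funext => z; rewrite /= !hornerE.
apply: (@closed_comp C R (fun z => cabs (z ^+ m - 1)) [set x | x = 1]); last exact: closed_eq.
rewrite E => z _; apply: continuous_comp; [exact: cts_horner|exact: cts_cabs].
Qed.

(** The pointwise inequality [f^+ + c <= max (f + c, 0) + f^-] integrates to a comparison of the
    integrals of [f^+] and [f^-]; if the latter is infinite, their difference is [-oo] by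
    convention. *)
Lemma integral_le0_of_shift (nu : probability C R) (f : C -> \bar R) (c : R) :
  measurable_fun setT f -> 0 <= c ->
  (\int[nu]_w maxe (f w + c%:E) 0 <= c%:E)%E -> (\int[nu]_w f w <= 0)%E.
Proof.
move=> mf c0 fc; rewrite integralE.
have mG : measurable_fun setT (fun w => maxe (f w + c%:E) 0)%E.
  apply: measurable_maxe; last exact: measurable_cst.
  by apply: emeasurable_funD => //; exact: measurable_cst.
have mp : measurable_fun setT f^\+%E by exact: measurable_funepos.
have mn : measurable_fun setT f^\-%E by exact: measurable_funeneg.
have G0 w : (0 <= maxe (f w + c%:E) 0)%E by rewrite le_max lexx orbT.
have H : (\int[nu]_w f^\+ w + c%:E <= c%:E + \int[nu]_w f^\- w)%E.
  apply: (@le_trans _ _ (\int[nu]_w maxe (f w + c%:E) 0 + \int[nu]_w f^\- w)%E); last exact: leeD2r.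
  have -> : (\int[nu]_w f^\+ w + c%:E = \int[nu]_w (f^\+ w + c%:E))%E.
    rewrite ge0_integralD//; first rewrite integral_cst//; congr (_ + _)%E.
    by rewrite -[LHS]mule1; congr (_ * _)%E; apply/esym; exact: probability_setT.
  rewrite -ge0_integralD//.
  apply: ge0_le_integral => //.
  - by move=> w _; rewrite adde_ge0.
  - by apply: (emeasurable_funD mp); exact: measurable_cst.
  - exact: (emeasurable_funD mG mn).
  move=> w _; rewrite funeposE funenegE; case: (f w) => [x| |] /=.
  - rewrite -EFinD -!EFin_max -!EFinD lee_fin /Order.max.
    by case: (ltP (x + c) 0) => ?; case: (ltP x 0) => ?; case: (ltP (- x) 0) => ?; lra.
  - by rewrite [maxe -oo%E _](max_r (leNye _)) (max_l (leey _)).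
  - by rewrite [maxe +oo%E _](max_l (leey _)) addey ?leey// max_r ?leNye.
have : (0 <= \int[nu]_w f^\- w)%E by exact: integral_ge0.
move: H; case: (\int[nu]_w f^\- w)%E => [y| |] //=; last by rewrite addeNy leNye.
by rewrite [leRHS]addeC leeD2rE// EFinN sube_le0.
Qed.

(** For fixed [t], the product of the [|z - r j * petal m t|] is [|z^m - petal m t ^ m| = |(1 - z^m)
    - circ t|]. For [z] on the lemniscate, [1 - z^m] is on the circle, so the potential of [nu] at
    [z] is one [m]-th of a potential already known to be nonpositive. *)
Lemma lemniscate_energy m : (0 < m)%N ->
  exists2 nu : probability C R, nu (~` lemniscate m) = 0%E & (log_energy nu <= 0)%E.
Proof.
move=> m0; have [r rE] := subrX_factor m0.
have [nu nuE] := @uniform_mixture R m _ m0 (fun j => measurable_petal m (r j)).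
have m0R : 0 < m%:R :> R by rewrite ltr0n.
have mD : measurable (lemniscate m) by apply: closed_measurableC; exact: closed_lemniscate.
have XX j t : (j < m)%N -> 0 <= t <= 1 -> (r j * petal m t) ^+ m = 1 - circ t.
  move=> jm t01; rewrite -(petalX m0 t01); apply/eqP; rewrite -subr_eq0 rE.
  by apply/prodf_eq0; exists (Ordinal jm) => //=; rewrite subrr.
have XD j t : (j < m)%N -> 0 <= t <= 1 -> lemniscate m (r j * petal m t).
  by move=> jm t01; rewrite /lemniscate/= XX// addrAC subrr add0r cabsN cabs_circ.
have nuD : nu (~` lemniscate m) = 0%E.
  rewrite -(setIT (~` _)) -integral_indic//; last exact: measurableC.
  rewrite nuE; last 2 first.
  - by apply/measurable_EFinP; apply: measurable_indic; exact: measurableC.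
  - by move=> z; rewrite lee_fin.
  rewrite big1 ?mule0// => j _; apply: integral0_eq => t /=; rewrite in_itv/= => t01.
  by rewrite indicE memNset//=; apply; exact: XD.
exists nu => //.
have pot z : lemniscate m z -> (\int[nu]_w (- lne (cabs (z - w)%R)%:E) <= 0)%E.
  move=> Dz; have z2 : cabs z <= 2 by apply: (lemniscate_le2 m0); rewrite Dz.
  have mG : measurable_fun setT (fun w => maxe (nlne (cabs (z - w)%R) + (ln 4)%:E) 0)%E.
    apply: measurable_maxe; last exact: measurable_cst.
    by apply: emeasurable_funD; [exact: measurable_nlne_dist|exact: measurable_cst].
  have l4 : 0 <= ln 4 :> R by rewrite ln_ge0// ler1n.
  (* Points of the lemniscate have modulus at most 2, hence mutual distances at most 4: there the
     maximum with 0 changes nothing, and elsewhere it keeps the integrand nonnegative. *)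
  apply: (@integral_le0_of_shift nu _ (ln 4)) => //; first exact: measurable_nlne_dist.
  rewrite nuE//; last by move=> w; rewrite le_max lexx orbT.
  rewrite -ge0_integral_sum//; last 2 first.
  - by move=> j; apply: measurable_funTS; apply: (measurableT_comp mG); exact: measurable_petal.
  - by move=> j t _; rewrite le_max lexx orbT.
  (* The [m] shifts by [ln 4], less the [ln 3] contained in [lnpot3]. *)
  have c0 : 0 <= m%:R * ln 4 - ln 3 :> R.
    have : ln 3 <= ln 4 :> R by rewrite ler_ln ?posrE// ler_nat.
    have : 1 <= m%:R :> R by rewrite ler1n.
    by nra.
  have -> : (\int[leb]_(t in `[0%R, 1%R]) \sum_(j < m)
       maxe (nlne (cabs (z - r j * petal m t)%R) + (ln 4)%:E) 0 =
     \int[leb]_(t in `[0%R, 1%R]) (lnpot3 (1 - z ^+ m)%R t + (m%:R * ln 4 - ln 3)%:E))%E.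
    apply: eq_integral => t; rewrite inE/= in_itv/= => t01.
    transitivity (\sum_(j < m) (nlne (cabs (z - r j * petal m t)%R) + (ln 4)%:E))%E.
      apply: eq_bigr => j _; apply: max_l.
      have : (nlne 4%R <= nlne (cabs (z - r j * petal m t)%R))%E.
        apply: nlne_le; apply: le_trans (le_cabsD _ _) _; rewrite cabsN.
        have : cabs (r j * petal m t) <= 2.
          by apply: (lemniscate_le2 m0); rewrite (XD j t (ltn_ord j) t01).
        by lra.
      by rewrite nlneE// EFinN => h; rewrite -(@subee _ (ln 4)%:E)// addeC leeD2r.
    rewrite big_split/= nlne_prod; last by move=> j; exact: cabs_ge0.
    rewrite sumEFin sumr_const card_ord -[_ *+ m]mulr_natl.
    rewrite /lnpot3 -addeA -EFinD; congr (nlne _ + _%:E)%E; last by ring.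
    have -> : 1 - z ^+ m - circ t = - (z ^+ m - petal m t ^+ m) by rewrite petalX//; ring.
    rewrite cabsN rE; elim/big_rec2 : _ => [|j x y _ ->]; first by rewrite cabs1.
    by rewrite cabsM.
  have z1 : cabs (1 - z ^+ m) = 1 by rewrite cabsC.
  rewrite ge0_integralD//; last 2 first.
  - by move=> t _; apply: lnpot3_ge0; rewrite z1 ler1n.
  - by apply: measurable_funTS; exact: measurable_lnpot3.
  rewrite integral_cst//= lebesgue_measure_itv/= lte_fin ltr01 oppr0 adde0 mule1.
  have -> : (ln 4)%:E = ((m%:R^-1)%:E * (m%:R * ln 4)%:E)%E :> \bar R.
    by rewrite -EFinM mulKf// gt_eqF.
  rewrite lee_pmul2l// ?lte_fin ?invr_gt0//.
  apply: (@le_trans _ _ ((ln 3)%:E + (m%:R * ln 4 - ln 3)%:E)%E).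
    by apply: leeD2r; exact: integral_lnpot3.
  by rewrite -EFinD lee_fin addrC subrK.
(* The potential [h] is nonpositive on the lemniscate, which carries [nu], so its positive part has
   integral 0. *)
rewrite /log_energy integralE; set h := (fun z => \int[nu]_w _)%E.
have -> : (\int[nu]_z h^\+ z = 0)%E.
  apply: (ge0_integral_ae0 mD nuD) => // z Dz.
  by rewrite funeposE max_r//; exact: pot.
by rewrite add0e oppe_le0; exact: integral_ge0.
Qed.

End LemniscateEnergy.

(** * The lemniscate in the boundary of the hull, capacity and growth *)

Section PolynomialHull.
Variable R : realType.
Local Notation C := R[i].
Implicit Types (z w : C) (K : set C).

Lemma has_ub_horner K (p : {poly C}) (M : R) : (forall w, K w -> cabs w <= M) ->
  has_ubound [set cabs p.[w] | w in K].
Proof.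
move=> KM; have cM := @compact_disc R M.
have : compact ((fun w => p.[w]) @` [set w : C | cabs w <= M]).
  by apply: continuous_compact => //; apply: continuous_subspaceT; exact: cts_horner.
move=> /compact_cabs_bounded[B _ HB]; exists B => _ [w Kw <-].
by apply: HB; exists w => //=; exact: KM.
Qed.

Lemma sub_Pch K (M : R) : (forall w, K w -> cabs w <= M) -> K `<=` Pch K.
Proof.
move=> KM z Kz p _; apply: ub_le_sup; first exact: has_ub_horner KM.
by exists z.
Qed.

(** Away from 0 the point is pushed radially: for [v = z^m], [|v - 1| = 1] means [|v|^2 = 2 Re v],
    whence [|t v - 1|^2 = 1 + t (t - 1) |v|^2 > 1] for [t > 1]. At 0, where the petals meet, the way
    out is along an [m]-th root of [-1]. *)
Lemma near_lemniscate_gt1 m z : (0 < m)%N -> lemniscate m z ->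
  forall e : R, 0 < e -> exists2 w, cabs (w - z) < e & 1 < cabs (w ^+ m - 1).
Proof.
move=> m0 Dz e e0; have [->|z0] := eqVneq z 0.
  pose w : C := (e / 2)%:C * cis (pi / m%:R).
  have e2 : 0 < e / 2 by rewrite divr_gt0.
  exists w.
    by rewrite subr0 /w cabsM cabs_cis mulr1 cabs_real gtr0_norm//; lra.
  have -> : w ^+ m - 1 = - ((e / 2) ^+ m + 1)%:C.
    rewrite /w exprMn cisX mulrC -rmorphXn/=.
    have -> : m%:R * (pi / m%:R) = pi :> R by field; rewrite pnatr_eq0 -lt0n.
    rewrite /cis cospi sinpi; apply/eqP; rewrite eq_complex/=.
    by apply/andP; split; apply/eqP; ring.
  by rewrite cabsN cabs_real gtr0_norm ?ltrDr ?addr_gt0// exprn_gt0.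
pose s := 1 + e / (2 * cabs z).
have z0' : 0 < cabs z by rewrite cabs_gt0.
have s1 : 1 < s by rewrite ltrDl divr_gt0// mulr_gt0.
exists (s%:C * z).
  have -> : s%:C * z - z = (e / (2 * cabs z))%:C * z.
    by rewrite /s rmorphD/= rmorph1; ring.
  rewrite cabsM cabs_real gtr0_norm ?divr_gt0// ?mulr_gt0//.
  have -> : e / (2 * cabs z) * cabs z = e / 2 by field; rewrite gt_eqF.
  by lra.
have sm : 1 < s ^+ m by rewrite exprn_egt1// -lt0n.
have zm : 0 < cabs (z ^+ m) by rewrite cabs_gt0 expf_neq0.
rewrite exprMn -rmorphXn/=; rewrite /lemniscate/= in Dz; move: (s ^+ m) sm (z ^+ m) zm Dz => t t1 v v0.
move=> /(congr1 (fun x => x ^+ 2)); rewrite expr1n cabs_sqr => v1.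
rewrite -(@ltr_pXn2r _ 2)// ?nnegrE ?cabs_ge0// expr1n cabs_sqr.
have := exprn_gt0 2 v0; rewrite cabs_sqr.
case: v {v0} v1 => a b /= v1 v0.
have a0 : 0 < 2 * a by move: v1 v0; rewrite !expr2; lra.
have : 0 < (t * (t - 1)) * (2 * a) by rewrite mulr_gt0// mulr_gt0//; lra.
have -> : 2 * a = a ^+ 2 + b ^+ 2 by move: v1; rewrite !expr2; lra.
have -> : (t * a - 0 * b - 1) ^+ 2 + (t * b + 0 * a - 0) ^+ 2 =
  1 + t * (t * (a ^+ 2 + b ^+ 2) - 2 * a) by ring.
have -> : 2 * a = a ^+ 2 + b ^+ 2 by move: v1; rewrite !expr2; lra.
by lra.
Qed.

(** The polynomial [X^m - 1] has sup norm at most 1 on the set, so it excludes from the hull the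
    nearby points where its modulus exceeds 1. *)
Lemma lemniscate_sub_boundary m : (0 < m)%N ->
  lemniscate m `<=` boundary (Pch [set z : C | `|z ^+ m - 1| <= 1]).
Proof.
move=> m0 z Dz; set E := [set z | _].
have EE w : E w <-> cabs (w ^+ m - 1) <= 1.
  by rewrite /E /= normE -(rmorph1 (@real_complex R)) lecR.
have E2 w : E w -> cabs w <= 2 by move=> /EE; exact: lemniscate_le2.
split; first by apply: subset_closure; apply: (sub_Pch E2); apply/EE; rewrite Dz.
move=> /nbhs_cabsP[e e0 eP].
have [w we w1] := near_lemniscate_gt1 m0 Dz e0.
have := eP w we ('X^m - 1) (monic_neq0 (monicXnsubC 1 m0)).
rewrite !hornerE leNgt => /negP; apply; apply: le_lt_trans w1.
apply: ge_sup; first by exists (cabs (z ^+ m - 1)); exists z; rewrite ?hornerE//; apply/EE; rewrite Dz.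
by move=> _ [v /EE v1 <-]; rewrite !hornerE.
Qed.

Lemma capacity_ge1 m K : (0 < m)%N -> lemniscate m `<=` K -> measurable K ->
  (1 <= capacity K)%E.
Proof.
move=> m0 DK mK; have [nu nuD nuE] := lemniscate_energy R m0.
rewrite /capacity -expeR0 lee_expeR oppe_ge0.
apply: le_trans nuE; apply: ereal_inf_lbound; exists nu => //=.
apply: (subset_measure0 _ _ _ nuD); [exact: measurableC| |exact: subsetC].
by apply: measurableC; apply: closed_measurableC; exact: closed_lemniscate.
Qed.

(** The limit exceeds [exp (- eps)], hence so do the terms eventually, and logarithms give the
    claim. The rank is [n0.+1] so that [n] is positive. *)
Lemma ln_root_growth (k : nat -> R) (c : \bar R) : (forall n, 0 < k n) -> (1 <= c)%E ->
  (k n `^ (- n%:R^-1))%:E @[n --> \oo] --> c ->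
  forall eps : R, 0 < eps -> exists n0, forall n, (n0 <= n)%N -> ln (k n) <= eps * n%:R.
Proof.
move=> k0 c1 kc eps e0.
have ec : ((expR (- eps))%:E < c)%E.
  by apply: lt_le_trans c1; rewrite lte_fin expR_lt1 oppr_lt0.
have [n0 _ H] : \forall n \near \oo, ((expR (- eps))%:E < (k n `^ (- n%:R^-1))%:E)%E.
  apply: (kc [set y | ((expR (- eps))%:E < y)%E]).
  by apply: open_nbhs_nbhs; split => //; exact: open_ereal_gt_ereal.
exists n0.+1 => n n0n; have := H n (ltnW n0n); rewrite /= lte_fin.
have n1 : 0 < n%:R :> R by rewrite ltr0n; exact: leq_ltn_trans n0n.
rewrite -ltr_ln ?posrE ?expR_gt0 ?powR_gt0// expRK ln_powR mulNr ltrN2.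
by rewrite mulrC ltr_pdivrMr// => /ltW.
Qed.

End PolynomialHull.

(** * Specialization to [f = X^m - 1] *)

Theorem mainTheorem5 (R : realType) (m : nat) (hm : (1 <= m)%N)
    (mu : {finite_measure set R[i] -> \bar R})
    (mu_compact : compact (msupp mu)) (mu_infinite : infinite_set (msupp mu))
    (p : nat -> {poly R[i]}) (hp : orthonormal_polys mu p)
    (mu_regular : regular_on [set z : R[i] | `|z ^+ m - 1| <= 1] mu) :
  exists N : set nat, density_one R N /\
    forall K : set (sphere R), compact K ->
      K `<=` ~` (@to_sphere R @` convex_hull (msupp mu)) ->
      {uniform K, (fun n => sphere_quot (('X^m - 1) * p (n - m)%N) (p n))
                    @ within N \oo --> cst (1 : R[i])}.
Proof.
have m0 : (0 < m)%N by [].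
have [[q hq qc] SE bS] := mu_regular.
have DS : lemniscate m `<=` msupp mu.
  exact: subset_trans (lemniscate_sub_boundary m0) bS.
have c1 : (1 <= capacity (msupp mu))%E.
  apply: (capacity_ge1 m0 DS); apply: closed_measurableC; exact: msupp_closed.
have f1 w : msupp mu w -> cabs ('X^m - 1 : {poly R[i]}).[w] <= 1.
  move=> /SE/=; rewrite !hornerE normE.
  by rewrite -(rmorph1 (@real_complex R)) lecR.
apply: (uniform_ratio mu_compact hp (monicXnsubC 1 m0) (size_XnsubC 1 m0)) => //.
  (* The origin is on the lemniscate, hence in the support. *)
  by exists 0; apply: DS; rewrite /lemniscate/= expr0n gtn_eqF// sub0r cabsN cabs1.
move=> eps e0.
have [n0 H] := ln_root_growth (kappa_gt0 hq) c1 qc e0.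
(* The growth bound holds for the sequence [q] provided by regularity and passes to [p]. *)
by exists n0 => n n0n; rewrite (kappa_unique mu_compact hp hq); exact: H.
Qed.
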